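(* There is a polynomial-time approximation scheme for $\alpha_{\mathrm{B,dec}}$-SU-CC: for every fixed constant $r$ with $0<r<1$ there is a polynomial-time algorithm that on every instance outputs a $K$-assignment $\Phi$ with $\ell_1(\Phi)\ge r\cdot\mathrm{OPT}$.
   Context: Agents $N=[n]$, alternatives $A=\{a_1,\dots,a_m\}$; each agent $i$ has a strict linear order on $A$, $\mathrm{pos}_i(a)$ the position of $a$ ($1$ = best). Borda satisfaction: $\ell_1(\Phi)=\sum_i(m-\mathrm{pos}_i(\Phi(i)))$. An instance of $\alpha_{\mathrm{B,dec}}$-SU-CC consists of the agents, alternatives, profile and a positive integer $K$; a $K$-assignment is any $\Phi:N\to A$ with $|\Phi(N)|\le K$; $\mathrm{OPT}$ is the maximum of $\ell_1$ over all $K$-assignments. *)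

(* Defs.v *)
From mathcomp Require Import all_boot all_order all_algebra.
From mathcomp Require Import fingroup perm.
From mathcomp Require Import reals.
Set Implicit Arguments. Unset Strict Implicit. Unset Printing Implicit Defensive.
Import Order.TTheory GRing.Theory Num.Theory.

Inductive sym := SB | S0 | S1 | SSep.
Inductive move := MoveL | MoveR | MoveN.

Definition is_blank (s : sym) : bool := if s is SB then true else false.

Record TM := {
  tm_nstates : nat;
  tm_start : 'I_tm_nstates.+1;
  tm_halt : 'I_tm_nstates.+1;
  tm_delta : 'I_tm_nstates.+1 -> sym -> 'I_tm_nstates.+1 * sym * move
}.

(* configuration: state, left part of tape (reversed, nearest cell first),
   scanned symbol, right part of the tape; unlisted cells are blank *)
Record config (M : TM) := Config {
  c_state : 'I_(tm_nstates M).+1;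
  c_left : seq sym;
  c_head : sym;
  c_right : seq sym
}.

Definition step (M : TM) (c : config M) : config M :=
  if c_state c == @tm_halt M then c else
  let: (q', w, mv) := @tm_delta M (c_state c) (c_head c) in
  match mv with
  | MoveN => Config q' (c_left c) w (c_right c)
  | MoveL => match c_left c with
             | [::] => Config q' [::] SB (w :: c_right c)
             | x :: l => Config q' l x (w :: c_right c)
             end
  | MoveR => match c_right c with
             | [::] => Config q' (w :: c_left c) SB [::]
             | x :: r => Config q' (w :: c_left c) x r
             end
  end.

Definition init_config (M : TM) (x : seq sym) : config M :=
  match x with
  | [::] => Config (@tm_start M) [::] SB [::]
  | s :: r => Config (@tm_start M) [::] s r
  end.

Definition run (M : TM) (t : nat) (x : seq sym) : config M :=
  iter t (@step M) (init_config M x).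

Fixpoint take_nonblank (s : seq sym) : seq sym :=
  match s with
  | [::] => [::]
  | a :: r => if is_blank a then [::] else a :: take_nonblank r
  end.

Definition output (M : TM) (c : config M) : seq sym :=
  take_nonblank (c_head c :: c_right c).

Definition halts_within (M : TM) (x : seq sym) (T : nat) (y : seq sym) : Prop :=
  exists2 t, t <= T & (c_state (run M t x) = @tm_halt M /\ output (run M t x) = y).

Fixpoint bits_aux (fuel n : nat) : seq sym :=
  match fuel with
  | 0 => [::]
  | f.+1 => if n is 0 then [::] else (if odd n then S1 else S0) :: bits_aux f n./2
  end.

Definition bin (n : nat) : seq sym := bits_aux n n.

Definition enc_nats (s : seq nat) : seq sym := flatten [seq bin a ++ [:: SSep] | a <- s].

(* Agents are 'I_n, alternatives are 'I_m. The preference of agent i   *)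
(* is a permutation  prof i : {perm 'I_m}  with  prof i a  the         *)
(* 0-based position of a (so pos_i(a) = prof i a + 1).                 *)

Definition pos (n m : nat) (prof : 'I_n -> {perm 'I_m}) (i : 'I_n) (a : 'I_m) : nat :=
  (prof i a).+1.

Definition ell1 (n m : nat) (prof : 'I_n -> {perm 'I_m}) (Phi : 'I_n -> 'I_m) : nat :=
  \sum_(i < n) (m - pos prof i (Phi i)).

Definition is_K_assignment (n m K : nat) (Phi : 'I_n -> 'I_m) : bool :=
  #|[set Phi i | i in 'I_n]| <= K.

Definition OPT (n m K : nat) (prof : 'I_n -> {perm 'I_m}) : nat :=
  \max_(Phi : {ffun 'I_n -> 'I_m} | is_K_assignment K Phi) ell1 prof Phi.

(* encoding of an instance: n, m, K, then for each agent (in order) its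
   ranking, i.e. the alternatives from most to least preferred *)
Definition ranking (m : nat) (s : {perm 'I_m}) : seq nat :=
  [seq val ((s^-1)%g j) | j <- enum 'I_m].

Definition enc_instance (n m K : nat) (prof : 'I_n -> {perm 'I_m}) : seq sym :=
  enc_nats ([:: n; m; K] ++ flatten [seq ranking (prof i) | i <- enum 'I_n]).

Definition enc_assignment (n m : nat) (Phi : 'I_n -> 'I_m) : seq sym :=
  enc_nats [seq val (Phi i) | i <- enum 'I_n].

(* Main.v *)
(** A tuple of [q] alternatives drawn uniformly at random leaves an agent with an
expected best position (counted from 0) of [\sum_(x < m) x ^ q / m ^ q], at most
[m / (q + 1)].  So some tuple of [q] alternatives has a total satisfaction of at
least [(1 - 2 / (q + 1)) * n * (m - 1)], which is at least [r * OPT] once [q] is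
large; for [K <= q] the optimum itself is attained by a tuple of size [K].  It is
therefore enough to try all tuples of [minn q K] alternatives, where [q] depends
on [r] only.

The search is a program in a small language of stacks whose loops run at most
[N] times, [N] being linear in the length of the input.  Every program of that
language is polynomial-time, so no running time analysis of the search itself is
needed.  The program is compiled to a machine with finitely many stacks, which
are stored one after the other on the tape, separated by blanks: the initial
tape then represents the input on the first stack, and the final tape outputs
that stack. *)

Require Import Defs.
From HB Require Import structures.
From mathcomp Require Import all_boot all_order all_algebra.
From mathcomp Require Import fingroup perm.
From mathcomp Require Import reals.
From mathcomp Require Import zify lra.
Set Implicit Arguments. Unset Strict Implicit. Unset Printing Implicit Defensive.
Import Order.TTheory GRing.Theory Num.Theory.
From Stdlib Require Import FunctionalExtensionality.

(** * Turing machines with an arbitrary finite set of states *)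

(** The numbers [m] and [K] are written in binary, so [K] may be exponentially larger than the
    input, while every loop is cut off after [N] rounds. A conversion to unary is thus exact only as
    long as it stays below [N]. This is harmless. As soon as there is an agent, its ranking lists
    [m] words, so [m] is below [N]; and since [N] is at least [q], a truncated [K] gives the same
    [minn q K]. Instances without agents are treated apart.

    The program needs no arithmetic to score a tuple: the Borda satisfaction of an agent is the
    number of words of its ranking that follow the first chosen one, so it suffices to push a mark
    for each of them.

    The constant 2 comes from [m <= 2 * (m - 1)] for [m >= 2]. It turns the bound [n * m / (q + 1)]
    on the total loss into a fraction of [n * (m - 1)], which bounds [OPT] from above; for [m = 1]
    all satisfactions vanish. *)

Definition sym_bits (a : sym) : bool * bool :=
  match a with
  | SB => (false, false) | S0 => (false, true)
  | S1 => (true, false) | SSep => (true, true)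
  end.

Definition bits_sym (b : bool * bool) : sym :=
  match b with
  | (false, false) => SB | (false, true) => S0
  | (true, false) => S1 | (true, true) => SSep
  end.

Lemma sym_bitsK : cancel sym_bits bits_sym.
Proof. by case. Qed.

HB.instance Definition _ := Equality.copy sym (can_type sym_bitsK).
HB.instance Definition _ := Finite.copy sym (can_type sym_bitsK).

Lemma is_blankE a : is_blank a = (a == SB).
Proof. by case: a. Qed.

Definition tape_eq (u v : seq sym) := forall i, nth SB u i = nth SB v i.

Lemma tape_eq_sym u v : tape_eq u v -> tape_eq v u.
Proof. by move=> uv i. Qed.

Lemma tape_eq_trans v u w : tape_eq u v -> tape_eq v w -> tape_eq u w.
Proof. by move=> uv vw i; rewrite uv. Qed.

Lemma tape_eq_cons a u v : tape_eq u v -> tape_eq (a :: u) (a :: v).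
Proof. by move=> uv [|i] //=. Qed.

Lemma tape_eq_behead u v : tape_eq u v -> tape_eq (behead u) (behead v).
Proof. by move=> uv i; rewrite !nth_behead. Qed.

Lemma tape_eq_blanks u k : tape_eq (u ++ nseq k SB) u.
Proof.
move=> i; rewrite nth_cat; case: ltnP => // le_ui.
by rewrite nth_nseq if_same nth_default.
Qed.

Lemma tape_eq_head u v : tape_eq u v -> head SB u = head SB v.
Proof. by move/(_ 0); rewrite !nth0. Qed.

Lemma take_nonblank_prefix u v r :
  SB \notin u -> tape_eq v (u ++ SB :: r) -> take_nonblank v = u.
Proof.
elim: u v => [|a u IHu] v /=.
  move=> _ eq_v; have := eq_v 0; case: v {eq_v} => //= b v ->.
  by [].
rewrite in_cons negb_or => /andP[na nu] eq_v.
have a0 : is_blank a = false by rewrite is_blankE eq_sym (negbTE na).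
have := eq_v 0; case: v eq_v => [|b v] eq_v /=.
  by move=> a_SB; rewrite -a_SB in a0.
move=> ->; rewrite a0 (IHu v) //.
exact: (tape_eq_behead eq_v).
Qed.

Section Machine.

Variables (Q : finType) (q0 qh : Q) (delta : Q -> sym -> Q * sym * move).

(** A [TM] has ordinals as states; numbering an arbitrary finite type lets the states below be
    tuples of a label, a mode, a symbol and a counter. *)
Definition enc_state (q : Q) : 'I_(#|Q|.-1).+1 := inord (enum_rank q).
Definition dec_state (i : 'I_(#|Q|.-1).+1) : Q := nth q0 (enum Q) i.

Lemma enc_stateK : cancel enc_state dec_state.
Proof.
move=> q; rewrite /dec_state /enc_state inordK ?nth_enum_rank //.
by apply: leq_trans (ltn_ord _) _; case: #|Q|.
Qed.

Definition machine : TM := {|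
  tm_nstates := #|Q|.-1;
  tm_start := enc_state q0;
  tm_halt := enc_state qh;
  tm_delta := fun i a =>
    let: (q, w, mv) := delta (dec_state i) a in (enc_state q, w, mv)
|}.

(* Tapes are compared up to trailing blanks; the scanned cell is the head of
   the right part [r]. *)
Definition at_cfg (c : config machine) (q : Q) (l r : seq sym) :=
  [/\ c_state c = enc_state q, tape_eq (c_left c) l
    & tape_eq (c_head c :: c_right c) r].

(** The bound [t] is only an upper bound, so it may be rounded up, and all configurations that
    represent the same tape are covered, so trailing blanks can be added or dropped in 0 steps. *)
Definition reach t q l r q' l' r' :=
  forall c, at_cfg c q l r ->
    exists2 t', t' <= t & at_cfg (iter t' (@step machine) c) q' l' r'.

Lemma reach_eq t q l r l' r' :
  tape_eq l l' -> tape_eq r r' -> reach t q l r q l' r'.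
Proof.
move=> ll rr c [cq cl cr]; exists 0 => //; split=> //.
- exact: tape_eq_trans cl ll.
- exact: tape_eq_trans cr rr.
Qed.

Lemma reach_refl q l r : reach 0 q l r q l r.
Proof. exact: reach_eq. Qed.

Lemma reach_trans t1 t2 q1 l1 r1 q l r q2 l2 r2 :
  reach t1 q l r q1 l1 r1 -> reach t2 q1 l1 r1 q2 l2 r2 ->
  reach (t1 + t2) q l r q2 l2 r2.
Proof.
move=> R1 R2 c /R1[t1' le1 /R2[t2' le2 at2]].
exists (t2' + t1'); last by rewrite iterD.
by rewrite addnC leq_add.
Qed.

Lemma reach_S t q1 l1 r1 q l r q2 l2 r2 :
  reach 1 q l r q1 l1 r1 -> reach t q1 l1 r1 q2 l2 r2 ->
  reach t.+1 q l r q2 l2 r2.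
Proof. exact: reach_trans. Qed.

Lemma reach_add0 t q1 l1 r1 q l r q2 l2 r2 :
  reach t q l r q1 l1 r1 -> reach 0 q1 l1 r1 q2 l2 r2 ->
  reach t q l r q2 l2 r2.
Proof. by rewrite -{2}[t]addn0; apply: reach_trans. Qed.

Lemma reach_leq t1 t2 q l r q' l' r' :
  t1 <= t2 -> reach t1 q l r q' l' r' -> reach t2 q l r q' l' r'.
Proof. by move=> le12 R c /R[t' le' at']; exists t' => //; apply: leq_trans le12. Qed.

Lemma step_delta c q l r q' w mv : at_cfg c q l r -> q != qh ->
  delta q (head SB r) = (q', w, mv) ->
  step c = match mv with
  | MoveN => @Config machine (enc_state q') (c_left c) w (c_right c)
  | MoveL => match c_left c with
             | [::] => @Config machine (enc_state q') [::] SB (w :: c_right c)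
             | x :: l => @Config machine (enc_state q') l x (w :: c_right c)
             end
  | MoveR => match c_right c with
             | [::] => @Config machine (enc_state q') (w :: c_left c) SB [::]
             | x :: r => @Config machine (enc_state q') (w :: c_left c) x r
             end
  end.
Proof.
move=> [cq cl cr] qNh dq; rewrite /step cq /= (can_eq enc_stateK) (negbTE qNh).
by rewrite enc_stateK -[c_head c]/(head SB (c_head c :: c_right c))
  (tape_eq_head cr) dq.
Qed.

Lemma reachN q l r q' w : q != qh -> delta q (head SB r) = (q', w, MoveN) ->
  reach 1 q l r q' l (w :: behead r).
Proof.
move=> qNh dq c at_c; exists 1 => //=; rewrite (step_delta at_c qNh dq).
case: at_c => [cq cl cr]; split=> //=; apply: tape_eq_cons.
exact: (tape_eq_behead cr).
Qed.

(** Rewriting the scanned symbol gives back [r] itself only up to a trailing blank, when [r] is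
    empty. *)
Lemma reach_stay q l r q' : q != qh ->
  delta q (head SB r) = (q', head SB r, MoveN) -> reach 1 q l r q' l r.
Proof.
move=> qNh dq.
have R1 : reach 1 q l r q' l (head SB r :: behead r) by apply: reachN.
apply: (reach_add0 R1); apply: reach_eq => //.
by case: r {dq R1} => //; case=> //; case.
Qed.

Lemma reachR q l r q' w : q != qh -> delta q (head SB r) = (q', w, MoveR) ->
  reach 1 q l r q' (w :: l) (behead r).
Proof.
move=> qNh dq c at_c; exists 1 => //=; rewrite (step_delta at_c qNh dq).
case: at_c => [cq cl cr]; have /= cr' := tape_eq_behead cr.
case: (c_right c) cr' => [|x u] cr'; split=> //=; try exact: tape_eq_cons.
by apply: tape_eq_trans cr'; case=> //; case.
Qed.

Lemma reachL q l r q' w : q != qh -> delta q (head SB r) = (q', w, MoveL) ->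
  reach 1 q l r q' (behead l) (head SB l :: w :: behead r).
Proof.
move=> qNh dq c at_c; exists 1 => //=; rewrite (step_delta at_c qNh dq).
case: at_c => [cq cl cr]; have /= cr' := tape_eq_behead cr.
have cl' := tape_eq_behead cl; rewrite -(tape_eq_head cl).
by case: (c_left c) cl' => [|x u] cl'; split=> //=; do 2 apply: tape_eq_cons.
Qed.

Lemma reach_halts x t y r : reach t q0 [::] x qh [::] (y ++ SB :: r) ->
  SB \notin y -> halts_within machine x t y.
Proof.
move=> R ynb; have at0 : at_cfg (init_config machine x) q0 [::] x.
  by case: x {R} => [|a x]; split=> //; case=> //; case.
have [t' le_t [cq _ cr]] := R _ at0.
by exists t' => //; split=> //; apply: take_nonblank_prefix cr.
Qed.

End Machine.

(** * Stack machines on a single tape *)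

Inductive stack_op :=
  | Nop
  | PushF of nat & sym
  | PushB of nat & sym
  | Pop of nat.

Definition store := nat -> seq sym.

Definition upd (s : store) i (v : seq sym) : store :=
  fun j => if j == i then v else s j.

Definition op_sem (o : stack_op) (s : store) : store * sym :=
  match o with
  | Nop => (s, SB)
  | PushF i a => (upd s i (a :: s i), SB)
  | PushB i a => (upd s i (rcons (s i) a), SB)
  | Pop i => (upd s i (behead (s i)), head SB (s i))
  end.

Definition op_ok k (o : stack_op) : bool :=
  match o with
  | Nop => true
  | PushF i a | PushB i a => (i < k) && ~~ is_blank a
  | Pop i => i < k
  end.

Definition op_target (o : stack_op) : nat :=
  match o with Nop => 0 | PushF i _ | PushB i _ | Pop i => i end.

(* The label of the next instruction depends on the popped symbol, which is
   [SB] when the stack is empty or when nothing is popped. *)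
Definition instr := (stack_op * (sym -> nat))%type.

(** The phases of one instruction. [Skip] moves right to the target stack, and [SkipB] on to its
    end. [Ins] shifts the rest of the tape one cell to the right, carrying the displaced symbol in
    the state. [ToEnd] runs to the end of the tape, from where [Del] shifts cells to the left; the
    symbol it finally carries is the popped one. [Back] rewinds to the first cell. *)
Inductive mode := Fetch | Skip | SkipB | Ins | ToEnd | Del | Back.

Definition mode_code (p : mode) : option (option (option (bool * bool))) :=
  match p with
  | Fetch => None | Skip => Some None | SkipB => Some (Some None)
  | Ins => Some (Some (Some (true, true)))
  | ToEnd => Some (Some (Some (true, false)))
  | Del => Some (Some (Some (false, true)))
  | Back => Some (Some (Some (false, false)))
  end.

Definition mode_decode p : mode :=
  match p with
  | None => Fetch | Some None => Skip | Some (Some None) => SkipB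
  | Some (Some (Some (true, true))) => Ins
  | Some (Some (Some (true, false))) => ToEnd
  | Some (Some (Some (false, true))) => Del
  | Some (Some (Some (false, false))) => Back
  end.

Lemma mode_codeK : cancel mode_code mode_decode.
Proof. by case. Qed.

HB.instance Definition _ := Equality.copy mode (can_type mode_codeK).
HB.instance Definition _ := Finite.copy mode (can_type mode_codeK).

(** * Separators on the tape *)

Definition blanks (v : seq sym) := count is_blank v.

Definition ends_blank (v : seq sym) := is_blank (last SB v).

(** A sweep over such a word counts its separators down; the count is still positive before each
    cell, so the sweep stops exactly at the end. *)
Lemma ends_blank_cons c v : ends_blank (c :: v) ->
  (0 < blanks (c :: v)) /\ ends_blank v.
Proof.
rewrite /ends_blank /blanks; elim: v c => [|b v IHv] c /=.
  by move=> ->.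
by move=> H; have [/= pos _] := IHv _ H; rewrite H addn_gt0 pos orbT.
Qed.

Lemma blanks0 u : SB \notin u -> blanks u = 0.
Proof.
elim: u => //= a u IHu; rewrite in_cons negb_or eq_sym => /andP[a0 /IHu ->].
by rewrite is_blankE (negbTE a0).
Qed.

Definition nonblank (s : store) := forall i, SB \notin s i.

Definition tape (s : store) i n := flatten [seq rcons (s j) SB | j <- iota i n].

Lemma blanks_cat u v : blanks (u ++ v) = blanks u + blanks v.
Proof. exact: count_cat. Qed.

Lemma ends_blank_cat u v : ends_blank u -> ends_blank v -> ends_blank (u ++ v).
Proof. by rewrite /ends_blank last_cat; case: v. Qed.

Lemma blanks_tape s i n : nonblank s -> blanks (tape s i n) = n.
Proof.
move=> nb; rewrite /tape; elim: n i => //= n IHn i.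
by rewrite blanks_cat IHn -cats1 blanks_cat blanks0.
Qed.

Lemma ends_blank_tape s i n : ends_blank (tape s i n).
Proof.
rewrite /tape; elim: n i => //= n IHn i; apply: ends_blank_cat => //.
by rewrite /ends_blank last_rcons.
Qed.

Lemma tape_split s i n : i < n ->
  tape s 0 n = tape s 0 i ++ s i ++ SB :: tape s i.+1 (n - i.+1).
Proof.
move=> lt_in; rewrite /tape -{1}(subnKC lt_in) iotaD map_cat flatten_cat.
have -> : iota 0 i.+1 = rcons (iota 0 i) i by rewrite -addn1 iotaD cats1.
by rewrite map_rcons flatten_rcons -catA cat_rcons add0n.
Qed.

Lemma tape_upd s i v j n : (i < j) || (j + n <= i) ->
  tape (upd s i v) j n = tape s j n.
Proof.
move=> out; congr flatten; apply/eq_in_map => l; rewrite mem_iota /upd.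
by case: eqP => // ->; case/orP: out; lia.
Qed.

Lemma op_sem_nonblank k o s : op_ok k o -> nonblank s -> nonblank (op_sem o s).1.
Proof.
move=> ok nb; case: o ok => [|i a|i a|i] //= ok j; rewrite /upd; case: eqP => // _.
- by rewrite in_cons negb_or nb andbT eq_sym -is_blankE; case/andP: ok.
- by rewrite mem_rcons in_cons negb_or nb andbT eq_sym -is_blankE; case/andP: ok.
- by apply: contra (nb i) => /mem_behead.
Qed.

Lemma op_target_lt k o : op_ok k o -> o <> Nop -> op_target o < k.
Proof. by case: o => [|i a|i a|i] //= => /andP[]. Qed.

Section StackMachine.

(* The tape holds the [k] stacks one after the other, each terminated by a
   blank; between two instructions the head is on the first cell. *)
Variables (k : nat) (code : seq instr).

Let L := size code.

(** Stacks have unbounded length, so the only thing a finite state can count is separators; the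
    counter reaches at most [k.+1], at the start of [Del] on stack 0. *)
Definition stack_state := ('I_L.+1 * mode * sym * 'I_k.+3)%type.

(** The label [L], one past the last instruction, serves as the halting state. *)
Definition fetch_at (pc : nat) : stack_state := (inord pc, Fetch, SB, ord0).

Definition instr_at (pc : nat) : instr := nth (Nop, fun _ => L) code pc.

Definition stack_delta (q : stack_state) (c : sym) : stack_state * sym * move :=
  let: (pc, ph, a, j) := q in
  let: (o, nx) := instr_at pc in
  let st ph' a' (j' : nat) : stack_state := (pc, ph', a', inord j') in
  let i := op_target o in
  let j' := j - is_blank c in
  match ph with
  | Fetch => if o is Nop then (fetch_at (nx SB), c, MoveN)
             else (st Skip SB i, c, MoveN)
  | Skip =>
    if j == 0 :> nat then
      match o with
      | PushF _ b => (st Ins b (k - i), c, MoveN)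
      | PushB _ b => (st SkipB b 0, c, MoveN)
      | _ => if is_blank c then (st Back SB i.+1, c, MoveN)
             else (st ToEnd SB (k - i), c, MoveN)
      end
    else (st Skip a j', c, MoveR)
  | SkipB => if is_blank c then (st Ins a (k - i), c, MoveN)
             else (st SkipB a 0, c, MoveR)
  | Ins => if j == 0 :> nat then (st Back SB k, c, MoveN)
           else (st Ins c j', a, MoveR)
  | ToEnd => if j == 0 :> nat then (st Del SB (k - i).+1, c, MoveN)
             else (st ToEnd a j', c, MoveR)
  | Del => if is_blank c && (j == 0 :> nat) then (st Back a i, c, MoveN)
           else (st Del c j', a, MoveL)
  | Back => if is_blank c && (j == 0 :> nat) then (fetch_at (nx a), c, MoveR)
            else (st Back a j', c, MoveL)
  end.

Definition stack_machine := machine (fetch_at 0) (fetch_at L) stack_delta.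

Notation R := (reach (fetch_at 0) (fetch_at L) stack_delta).

(** * One instruction as sweeps over the tape *)

Section Instruction.

Variables (pc : nat) (o : stack_op) (nx : sym -> nat).
Hypotheses (pcL : pc < L) (pcE : instr_at pc = (o, nx)) (o_ok : op_ok k o).

Let st ph a (j : nat) : stack_state := (inord pc, ph, a, inord j).

Let fetchNh ph a j : ph != Fetch -> st ph a j != fetch_at L.
Proof. by move=> phN; rewrite /st /fetch_at !xpair_eqE (negbTE phN) !andbF. Qed.

Let delta_st ph a j c : j < k.+3 ->
  stack_delta (st ph a j) c = 
  let i := op_target o in
  let j' := j - is_blank c in
  match ph with
  | Fetch => if o is Nop then (fetch_at (nx SB), c, MoveN)
             else (st Skip SB i, c, MoveN)
  | Skip =>
    if j == 0 then
      match o with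
      | PushF _ b => (st Ins b (k - i), c, MoveN)
      | PushB _ b => (st SkipB b 0, c, MoveN)
      | _ => if is_blank c then (st Back SB i.+1, c, MoveN)
             else (st ToEnd SB (k - i), c, MoveN)
      end
    else (st Skip a j', c, MoveR)
  | SkipB => if is_blank c then (st Ins a (k - i), c, MoveN)
             else (st SkipB a 0, c, MoveR)
  | Ins => if j == 0 then (st Back SB k, c, MoveN)
           else (st Ins c j', a, MoveR)
  | ToEnd => if j == 0 then (st Del SB (k - i).+1, c, MoveN)
             else (st ToEnd a j', c, MoveR)
  | Del => if is_blank c && (j == 0) then (st Back a i, c, MoveN)
           else (st Del c j', a, MoveL)
  | Back => if is_blank c && (j == 0) then (fetch_at (nx a), c, MoveR)
            else (st Back a j', c, MoveL)
  end.
Proof.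
move=> lt_j; rewrite /stack_delta /st.
rewrite (inordK (leqW pcL)) pcE (inordK lt_j).
by [].
Qed.

(** The surplus [j] is what remains of the counter once the separators of [v] are passed; it is 0 in
    both uses, where the mode then changes. *)
Lemma reach_skip ph a v j l r : ph \in [:: Skip; ToEnd] -> ends_blank v ->
  blanks v + j < k.+3 ->
  R (size v) (st ph a (blanks v + j)) l (v ++ r) (st ph a j) (rev v ++ l) r.
Proof.
move=> ph_in; elim: v l => [|c v IHv] l; first by move=> *; apply: reach_refl.
case/ends_blank_cons=> pos ev lt_k.
apply: reach_S (reachR (q' := st ph a (blanks v + j)) (w := c) _ _) _.
- by apply: fetchNh; case/orP: (ph_in) => [/eqP->|/predU1P[->|]].
- rewrite delta_st //=.
  have jE : is_blank c + blanks v + j - is_blank c = blanks v + j.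
    by rewrite -addnA addKn.
  have /negbTE jN0 : is_blank c + blanks v + j != 0.
    by move: pos; rewrite /blanks /=; case: (_ + _).
  by move: ph_in; rewrite !inE => /orP[] /eqP->; rewrite jN0 jE.
rewrite rev_cons cat_rcons; apply: IHv => //.
by apply: leq_ltn_trans lt_k; rewrite leq_add2r /blanks /= leq_addl.
Qed.

Lemma reach_ins a v l : ends_blank v -> blanks v < k.+3 ->
  R (size v) (st Ins a (blanks v)) l v
    (st Ins (last a v) 0) (rev (belast a v) ++ l) [::].
Proof.
elim: v a l => [|c v IHv] a l; first by move=> *; apply: reach_refl.
case/ends_blank_cons=> pos ev lt_k.
apply: reach_S (reachR (q' := st Ins c (blanks v)) (w := a) _ _) _.
- exact: fetchNh.
- rewrite delta_st //= addKn.
  by have /negbTE-> : is_blank c + blanks v != 0 by rewrite -lt0n.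
rewrite [belast _ _]/= rev_cons cat_rcons; apply: IHv => //.
by apply: leq_ltn_trans lt_k; rewrite /blanks /= leq_addl.
Qed.

Lemma reach_skipB a s l r : SB \notin s ->
  R (size s).+1 (st SkipB a 0) l (s ++ SB :: r)
    (st Ins a (k - op_target o)) (rev s ++ l) (SB :: r).
Proof.
elim: s l => [|c s IHs] l.
  by move=> _; apply: reachN; [exact: fetchNh | rewrite delta_st].
rewrite in_cons negb_or eq_sym => /andP[c0 sNB].
apply: reach_S (reachR (q' := st SkipB a 0) (w := c) _ _) _.
- exact: fetchNh.
- by rewrite delta_st //= is_blankE (negbTE c0).
by rewrite rev_cons cat_rcons; apply: IHs.
Qed.

(** Every cell receives the symbol of its right neighbour. All blanks of [c :: v] are paid for by
    the counter, so the first blank met with counter 0 is the one that precedes the stack. *)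
Lemma reach_del a c v l rest : is_blank (head SB l) ->
  blanks (c :: v) < k.+3 ->
  R (size v).+1 (st Del a (blanks (c :: v))) (v ++ l) (c :: rest)
    (st Del (last c v) 0) (behead l)
    (head SB l :: rev (a :: belast c v) ++ rest).
Proof.
move=> l0; elim: v a c rest => [|b v IHv] a c rest lt_k.
  apply: reachL; first exact: fetchNh.
  by rewrite delta_st //= /blanks /= addn0 subnn; case: is_blank.
apply: reach_S (reachL (q' := st Del c (blanks (b :: v))) (w := a) _ _) _.
- exact: fetchNh.
- rewrite delta_st //= addKn.
  by case: is_blank.
rewrite /= rev_cons cat_rcons; apply: IHv.
by apply: leq_ltn_trans lt_k; rewrite {2}/blanks /= leq_addl.
Qed.

Lemma reach_back a v rest : blanks v < k.+3 ->
  R (size v).+1 (st Back a (blanks v)) (behead v) (head SB v :: rest)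
    (fetch_at (nx a)) [::] (rev v ++ rest).
Proof.
(* The head turns round on the blank to the left of the tape, which then appears in the left part
   but is invisible up to [tape_eq]. *)
move=> lt_k; suff H : R (size v).+1 (st Back a (blanks v)) (behead v) (head SB v :: rest)
    (fetch_at (nx a)) [:: SB] (rev v ++ rest).
  apply: (reach_add0 H); apply: reach_eq => //.
  by case=> [|[]].
elim: v rest lt_k => [|c v IHv] rest lt_k.
  by apply: reachR; [exact: fetchNh | rewrite delta_st].
apply: reach_S (reachL (q' := st Back a (blanks v)) (w := c) _ _) _.
- exact: fetchNh.
- rewrite delta_st //= addKn.
  by case: is_blank.
rewrite /= rev_cons cat_rcons; apply: IHv.
by apply: leq_ltn_trans lt_k; rewrite {2}/blanks /= leq_addl.
Qed.

Lemma fetch_st : fetch_at pc = st Fetch SB 0.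
Proof. by congr (_, _); apply: val_inj; rewrite /= inordK. Qed.

Lemma fetch_atN : fetch_at pc != fetch_at L.
Proof.
apply/eqP => /(congr1 (fun q : stack_state => nat_of_ord q.1.1.1)) /=.
by rewrite !inordK ?ltnS ?leqnn ?(ltnW pcL) // => pc_L; move: pcL; rewrite {1}pc_L ltnn.
Qed.

Lemma reach_find s : o <> Nop -> nonblank s ->
  let i := op_target o in
  R (size (tape s 0 i)).+1 (fetch_at pc) [::] (tape s 0 k)
    (st Skip SB 0) (rev (tape s 0 i)) (s i ++ SB :: tape s i.+1 (k - i.+1)).
Proof.
move=> oN nb i; have lt_ik : i < k.
  exact: op_target_lt o_ok oN.
apply: reach_S (reachN (q' := st Skip SB i) (w := head SB (tape s 0 k)) _ _) _.
- exact: fetch_atN.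
- by rewrite fetch_st delta_st //= -/i; case: o oN.
rewrite (tape_split _ lt_ik); set v := _ ++ _ :: _.
set w := _ :: _; have -> : w = tape s 0 i ++ v.
  rewrite /w; case E: (_ ++ v) => //; move/(congr1 size): E.
  by rewrite /v !size_cat /=; lia.
rewrite -[rev _]cats0 -{2}[i](blanks_tape 0 i nb) -[blanks _]addn0.
apply: reach_skip => //; first exact: ends_blank_tape.
by rewrite blanks_tape // addn0; lia.
Qed.

(** The common end of both pushes: [u] is the part of the tape before the insertion point and [v]
    the part that is shifted. *)
Lemma reach_insert a v u : ~~ is_blank a -> op_target o < k ->
  ends_blank v -> blanks v = k - op_target o -> blanks u = op_target o ->
  R (2 * size v + size u).+3 (st Ins a (k - op_target o)) (rev u) v
    (fetch_at (nx SB)) [::] (u ++ a :: v).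
Proof.
move=> a0 lt_ok ev bv bu; have vN : v != [::].
  by apply/eqP => v0; move: bv; rewrite v0 /=; lia.
(* The symbol still carried at the end is the last separator, and the cell reached is already blank,
   so it need not be written. *)
have lv : last a v = SB.
  by move: ev; rewrite /ends_blank is_blankE; case: v vN {bv} => //= b v _ /eqP.
have split : rcons (belast a v) SB = a :: v by rewrite -lv -lastI.
have R1 := @reach_ins a v (rev u) ev.
rewrite bv lv in R1; have {}R1 := R1 ltac:(lia).
have R2 := @reachN _ (fetch_at 0) (fetch_at L) stack_delta (st Ins SB 0)
  (rev (belast a v) ++ rev u) [::] (st Back SB k) SB.
have {}R2 := R2 (fetchNh _ _ (isT : Ins != Fetch)) _.
have {}R2 := R2 ltac:(by rewrite delta_st).
have R3 := @reach_back SB (SB :: rev (belast a v) ++ rev u) [::].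
have bE : blanks (SB :: rev (belast a v) ++ rev u) = k.
  rewrite [LHS]/(1 + blanks _) blanks_cat /blanks !count_rev -!/(blanks _) bu.
  move/(congr1 blanks): split; rewrite -cats1 blanks_cat /= (negbTE a0) add0n.
  by rewrite -/(blanks v) bv /=; lia.
rewrite bE in R3; have {}R3 := R3 ltac:(lia).
rewrite cats0 rev_cons rev_cat !revK in R3.
have -> : u ++ a :: v = rcons (u ++ belast a v) SB by rewrite -split rcons_cat.
apply: reach_leq (reach_trans R1 (reach_trans R2 R3)).
by rewrite /= size_cat !size_rev size_belast; lia.
Qed.

Lemma reach_instr s : nonblank s ->
  R (3 * size (tape s 0 k) + 9) (fetch_at pc) [::] (tape s 0 k)
    (fetch_at (nx (op_sem o s).2)) [::] (tape (op_sem o s).1 0 k).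
Proof.
move=> nb; have : o = Nop \/ o <> Nop by case: o; [left|right|right|right].
case=> [oE | oN].
  apply: (@reach_leq _ _ _ _ 1); first by lia.
  have -> : tape (op_sem o s).1 0 k = tape s 0 k by rewrite oE.
  by apply: reach_stay fetch_atN _; rewrite fetch_st delta_st // oE.
have /= R1 := reach_find oN nb.
set i := op_target o in R1 *.
have lt_ik : i < k.
  exact: op_target_lt o_ok oN.
have szE : size (tape s 0 k) =
    size (tape s 0 i) + size (s i) + size (tape s i.+1 (k - i.+1)) + 1.
  by rewrite (tape_split s lt_ik) !size_cat /=; lia.
have updE v : tape (upd s i v) 0 k =
    tape s 0 i ++ v ++ SB :: tape s i.+1 (k - i.+1).
  rewrite (tape_split _ lt_ik) !tape_upd ?ltnSn ?add0n ?leqnn ?orbT //.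
  by rewrite {1}/upd eqxx.
set A := tape s 0 i in R1 szE updE; set B := tape s i.+1 _ in R1 szE updE.
have bA : blanks A = i by rewrite blanks_tape.
have bB : blanks B = k - i.+1 by rewrite blanks_tape.
have eB : ends_blank (SB :: B).
  by apply: (@ends_blank_cat [:: SB]); rewrite ?ends_blank_tape.
have eV : ends_blank (s i ++ SB :: B).
  by rewrite /ends_blank last_cat; exact: eB.
have bV : blanks (s i ++ SB :: B) = k - i.
  by rewrite blanks_cat blanks0 //= -/(blanks B) bB; lia.
case oE: o => [|j a|j a|j].
- by case: oN.
- have ji : j = i by rewrite /i oE.
  have a0 : ~~ is_blank a by move: o_ok; rewrite oE => /andP[].
  have R2 : R 1 (st Skip SB 0) (rev A) (s i ++ SB :: B)
      (st Ins a (k - i)) (rev A) (s i ++ SB :: B).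
    by apply: reach_stay; [exact: fetchNh | rewrite delta_st //= -/i oE].
  have R3 := reach_insert a0 lt_ik eV bV bA.
  rewrite /= ji updE; apply: reach_leq (reach_trans R1 (reach_trans R2 R3)).
  by rewrite -/A !size_cat /=; lia.
- have ji : j = i by rewrite /i oE.
  have a0 : ~~ is_blank a by move: o_ok; rewrite oE => /andP[].
  have R2 : R 1 (st Skip SB 0) (rev A) (s i ++ SB :: B)
      (st SkipB a 0) (rev A) (s i ++ SB :: B).
    by apply: reach_stay; [exact: fetchNh | rewrite delta_st //= oE].
  have R3 := @reach_skipB a (s i) (rev A) B (nb i).
  have bB' : blanks (SB :: B) = k - i by rewrite /= -/(blanks B) bB; lia.
  have bA' : blanks (A ++ s i) = i by rewrite blanks_cat (blanks0 (nb i)) addn0.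
  have R4 := reach_insert a0 lt_ik eB bB' bA'.
  rewrite /= ji updE cat_rcons catA; rewrite rev_cat in R4.
  apply: reach_leq (reach_trans R1 (reach_trans R2 (reach_trans R3 R4))).
  by rewrite -/A !size_cat /=; lia.
- have ji : j = i by rewrite /i oE.
  rewrite /= ji updE; case sE: (s i) R1 eV bV szE => [|b u] R1 eV bV szE /=.
    have R2 : R 1 (st Skip SB 0) (rev A) (SB :: B)
        (st Back SB i.+1) (rev A) (SB :: B).
      by apply: reach_stay; [exact: fetchNh | rewrite delta_st //= -/i oE].
    have R3 := @reach_back SB (SB :: rev A) B.
    have bE : blanks (SB :: rev A) = i.+1.
      by rewrite /blanks /= count_rev -/(blanks A) bA.
    rewrite bE rev_cons revK cat_rcons in R3; have {}R3 := R3 ltac:(lia).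
    apply: reach_leq (reach_trans R1 (reach_trans R2 R3)).
    by rewrite -/A /= size_rev; move: szE => /=; lia.
  have b0 : is_blank b = false.
    by have := nb i; rewrite sE in_cons negb_or is_blankE eq_sym => /andP[/negbTE].
  set v := (b :: u) ++ SB :: B in R1 eV bV.
  have R2 : R 1 (st Skip SB 0) (rev A) v (st ToEnd SB (k - i)) (rev A) v.
    by apply: reach_stay; [exact: fetchNh | rewrite delta_st //= -/i oE /= b0].
  have R3 := @reach_skip ToEnd SB v 0 (rev A) [::] isT eV.
  rewrite addn0 cats0 bV in R3; have {}R3 := R3 ltac:(lia).
  have R4 : R 1 (st ToEnd SB 0) (rev v ++ rev A) [::]
      (st Del SB (k - i).+1) (rev v ++ rev A) [::].
    by apply: reach_stay; [exact: fetchNh | rewrite delta_st].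
  (* The blank cell beyond the tape is made explicit: [reach_del] starts on a scanned symbol. *)
  have R4' : R 0 (st Del SB (k - i).+1) (rev v ++ rev A) [::]
      (st Del SB (k - i).+1) (rev v ++ rev A) [:: SB].
    by apply: reach_eq => //; case=> //; case.
  have hA : is_blank (head SB (rev A)).
    have : ends_blank A by apply: ends_blank_tape.
    by rewrite /ends_blank; case/lastP: (A) => // A' a; rewrite last_rcons rev_rcons.
  have R5 := @reach_del SB SB (rev v) (rev A) [::] hA.
  have bE : blanks (SB :: rev v) = (k - i).+1.
    by rewrite /blanks /= count_rev -/(blanks v) bV.
  have lE : last SB (rev v) = b by rewrite /v /= rev_cons last_rcons.
  rewrite bE lE cats0 in R5; have {}R5 := R5 ltac:(lia).
  set X := rev (SB :: _) in R5.
  (* The shift removes [b] and leaves two more blanks at the end, to be dropped in [R8]. *)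
  have XE : X = (u ++ SB :: B) ++ nseq 2 SB.
    have := lastI SB (rev v); rewrite lE => /(congr1 rev).
    rewrite rev_cons revK rev_rcons /v /= => -[E].
    by rewrite /X rev_cons -E -!cats1 -catA.
  set r6 := _ :: X in R5.
  have R6 : R 1 (st Del b 0) (behead (rev A)) r6 (st Back b i) (behead (rev A)) r6.
    by apply: reach_stay; [exact: fetchNh | rewrite delta_st //= hA -/i].
  have R7 := @reach_back b (rev A) X.
  rewrite revK /blanks count_rev -/(blanks A) bA in R7.
  have {}R7 := R7 ltac:(lia).
  have R8 : R 0 (fetch_at (nx b)) [::] (A ++ X) (fetch_at (nx b)) [::]
      (A ++ u ++ SB :: B).
    by rewrite XE catA; apply: reach_eq => //; apply: tape_eq_blanks.
  apply: reach_leq (reach_trans R1 (reach_trans R2 (reach_trans R3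
    (reach_trans R4 (reach_trans R4' (reach_trans R5 (reach_trans R6
    (reach_trans R7 R8)))))))).
  by rewrite -/A !size_rev /v; move: szE; rewrite !size_cat /=; lia.
Qed.

End Instruction.

(** * Runs of several instructions *)

Inductive mrun : nat -> nat -> store -> nat -> store -> Prop :=
  | mrun_stop pc s : mrun 0 pc s pc s
  | mrun_step t pc s pc' s' of pc < L &
      mrun t ((instr_at pc).2 (op_sem (instr_at pc).1 s).2)
        (op_sem (instr_at pc).1 s).1 pc' s' :
      mrun t.+1 pc s pc' s'.

Lemma mrun_trans t1 t2 pc s pc1 s1 pc2 s2 :
  mrun t1 pc s pc1 s1 -> mrun t2 pc1 s1 pc2 s2 -> mrun (t1 + t2) pc s pc2 s2.
Proof.
by elim=> // {}t1 {}pc {}s {}pc1 {}s1 lt_pc _ IH /IH; rewrite addSn; apply: mrun_step.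
Qed.

Lemma size_tape_op o s : op_ok k o ->
  size (tape (op_sem o s).1 0 k) <= (size (tape s 0 k)).+1.
Proof.
have sz i v : i < k -> size v <= (size (s i)).+1 ->
    size (tape (upd s i v) 0 k) <= (size (tape s 0 k)).+1.
  move=> lt_ik le_v; rewrite !(tape_split _ lt_ik) !tape_upd ?ltnSn ?add0n ?leqnn ?orbT //.
  by rewrite !size_cat {1}/upd eqxx /=; lia.
case: o => [|i a|i a|i] //=.
- by case/andP=> /sz-> //.
- by case/andP=> /sz-> //; rewrite size_rcons.
- by move/sz=> -> //; rewrite size_behead; lia.
Qed.

(** Each instruction lengthens the tape by at most one cell, so throughout the run the tape exceeds
    its initial length by at most [t], and one instruction costs a bounded number of sweeps. *)
Lemma reach_mrun t pc s pc' s' : all (fun c : instr => op_ok k c.1) code ->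
  mrun t pc s pc' s' -> nonblank s ->
  R (t * (3 * (size (tape s 0 k) + t) + 9)) (fetch_at pc) [::] (tape s 0 k)
    (fetch_at pc') [::] (tape s' 0 k) /\ nonblank s'.
Proof.
move=> ok; elim=> {t pc s pc' s'} [pc s nb|t pc s pc' s' lt_pc _ IH nb].
  by split=> //; apply: reach_refl.
have ok_pc : op_ok k (instr_at pc).1 by have /all_nthP := ok; apply.
have [R1 nb'] := IH (op_sem_nonblank ok_pc nb); split=> //.
have R0 := @reach_instr pc (instr_at pc).1 (instr_at pc).2 lt_pc
  (surjective_pairing _) ok_pc s nb.
apply: reach_leq (reach_trans R0 R1).
have := size_tape_op s ok_pc; nia.
Qed.

Definition init_store (x : seq sym) : store := upd (fun _ => [::]) 0 x.

Lemma stack_machine_halts t x s : 0 < k ->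
  all (fun c : instr => op_ok k c.1) code -> SB \notin x ->
  mrun t 0 (init_store x) L s ->
  halts_within stack_machine x (t * (3 * (size x + k + t) + 9)) (s 0).
Proof.
move=> k0 ok nbx run; have nb : nonblank (init_store x).
  by move=> i; rewrite /init_store /upd; case: eqP.
have [R1 nb'] := reach_mrun ok run nb.
have tape0 s' : tape s' 0 k = s' 0 ++ SB :: tape s' 1 k.-1.
  by rewrite (tape_split _ k0) subn1.
have blank1 n i : tape (init_store x) i.+1 n = nseq n SB.
  by rewrite /tape; elim: n i => //= n IHn i; rewrite IHn.
have tapeE : tape (init_store x) 0 k = x ++ nseq k SB.
  by rewrite tape0 blank1 -{2}(prednK k0).
have R0 : R 0 (fetch_at 0) [::] x (fetch_at 0) [::] (tape (init_store x) 0 k).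
  by rewrite tapeE; apply: reach_eq => //; apply: tape_eq_sym (tape_eq_blanks _ _).
have szE : size (tape (init_store x) 0 k) = size x + k.
  by rewrite tapeE size_cat size_nseq.
rewrite szE (tape0 s) in R1; have := reach_trans R0 R1; rewrite add0n => R2.
exact: reach_halts R2 (nb' 0).
Qed.

End StackMachine.

(** * Structured programs for stack machines *)

(* [WBr loop i f] pops stack [i] and runs [f r] on the popped symbol [r]
   ([SB] if the stack is empty); if [loop] holds this is repeated until the
   stack is found empty. *)
Inductive wcom :=
  | WOp of stack_op
  | WSeq of wcom & wcom
  | WBr of bool & nat & (sym -> wcom).

(** The two extra units of a branching pay for the pop and for the jump that ends each branch. A
    loop that finds its stack empty still runs [f SB] once before it exits. *)
Inductive wrun : wcom -> store -> store -> nat -> Prop :=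
  | wrun_op o s : wrun (WOp o) s (op_sem o s).1 1
  | wrun_seq c1 c2 s s1 s2 t1 t2 of wrun c1 s s1 t1 & wrun c2 s1 s2 t2 :
      wrun (WSeq c1 c2) s s2 (t1 + t2)
  | wrun_exit b i f s s1 t of ~~ (b && ~~ is_blank (head SB (s i))) &
      wrun (f (head SB (s i))) (upd s i (behead (s i))) s1 t :
      wrun (WBr b i f) s s1 t.+2
  | wrun_loop b i f s s1 s2 t1 t2 of b && ~~ is_blank (head SB (s i)) &
      wrun (f (head SB (s i))) (upd s i (behead (s i))) s1 t1 &
      wrun (WBr b i f) s1 s2 t2 :
      wrun (WBr b i f) s s2 (t1 + t2).+2.

Fixpoint wsize (c : wcom) : nat :=
  match c with
  | WOp _ => 1
  | WSeq c1 c2 => wsize c1 + wsize c2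
  | WBr _ _ f => 5 + (wsize (f SB) + wsize (f S0) + wsize (f S1) + wsize (f SSep))
  end.

(** Layout of a branching: the pop, then the four branches in turn, each followed by one [Nop] that
    jumps back or out. These five instructions are the 5 in [wsize]. *)
Definition branch_start off (f : sym -> wcom) (r : sym) : nat :=
  match r with
  | SB => off.+1
  | S0 => off.+2 + wsize (f SB)
  | S1 => off.+3 + wsize (f SB) + wsize (f S0)
  | SSep => off.+4 + wsize (f SB) + wsize (f S0) + wsize (f S1)
  end.

Fixpoint wcompile (off : nat) (c : wcom) : seq instr :=
  match c with
  | WOp o => [:: (o, fun _ => off.+1)]
  | WSeq c1 c2 => wcompile off c1 ++ wcompile (off + wsize c1) c2
  | WBr b i f =>
    let br r := rcons (wcompile (branch_start off f r) (f r))
      (Nop, fun _ => if b && ~~ is_blank r then off else off + wsize c) in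
    (Pop i, branch_start off f) :: br SB ++ br S0 ++ br S1 ++ br SSep
  end.

Fixpoint wcom_ok k (c : wcom) : bool :=
  match c with
  | WOp o => op_ok k o
  | WSeq c1 c2 => wcom_ok k c1 && wcom_ok k c2
  | WBr _ i f => [&& i < k, wcom_ok k (f SB), wcom_ok k (f S0),
                     wcom_ok k (f S1) & wcom_ok k (f SSep)]
  end.

Lemma size_wcompile off c : size (wcompile off c) = wsize c.
Proof.
elim: c off => [o|c1 IH1 c2 IH2|b i f IH] off //=.
  by rewrite size_cat IH1 IH2.
by rewrite !size_cat !size_rcons !IH; lia.
Qed.

Lemma wcompile_ok k off c : wcom_ok k c ->
  all (fun c : instr => op_ok k c.1) (wcompile off c).
Proof.
elim: c off => [o|c1 IH1 c2 IH2|b i f IH] off /=.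
- by rewrite andbT.
- by case/andP=> ok1 ok2; rewrite all_cat IH1 ?IH2.
by case/and5P=> -> ok1 ok2 ok3 ok4; rewrite !all_cat !all_rcons /= !IH.
Qed.

(** Jump targets are absolute, so a fragment is correct only at the offset for which it was
    compiled. *)
Definition code_at (code : seq instr) off p :=
  exists2 u, size u = off & exists v, code = u ++ p ++ v.

Lemma code_at_catl code off p q : code_at code off (p ++ q) -> code_at code off p.
Proof. by case=> u su [v ->]; exists u => //; exists (q ++ v); rewrite -!catA. Qed.

Lemma code_at_catr code off p q :
  code_at code off (p ++ q) -> code_at code (off + size p) q.
Proof.
case=> u su [v ->]; exists (u ++ p); first by rewrite size_cat su.
by exists v; rewrite -!catA.
Qed.

Lemma code_at_instr code off x p : code_at code off (x :: p) ->
  off < size code /\ instr_at code off = x.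
Proof.
case=> u su [v ->]; rewrite /instr_at size_cat /= -su; split; first by lia.
by rewrite nth_cat ltnn subnn.
Qed.

Lemma code_at_branch code off b i f r : code_at code off (wcompile off (WBr b i f)) ->
  code_at code (branch_start off f r)
   (rcons (wcompile (branch_start off f r) (f r))
   (Nop, fun _ => if b && ~~ is_blank r then off else off + wsize (WBr b i f))).
Proof.
pose br r := rcons (wcompile (branch_start off f r) (f r))
  (Nop, fun _ : sym => if b && ~~ is_blank r then off else off + wsize (WBr b i f)).
rewrite [wcompile off _](_ : _ =
  (Pop i, branch_start off f) :: br SB ++ br S0 ++ br S1 ++ br SSep) //.
rewrite -cat1s => /code_at_catr; rewrite [size _]/= addn1 -/(br r).
case: r => [/code_at_catl|/code_at_catr|/code_at_catr|/code_at_catr] //;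
  rewrite {1}/br size_rcons size_wcompile.
- by move/code_at_catl; congr code_at; rewrite /=; lia.
- move/code_at_catr/code_at_catl; rewrite {1}/br size_rcons size_wcompile.
  by congr code_at; rewrite /=; lia.
- move/code_at_catr/code_at_catr; rewrite {1 2}/br !size_rcons !size_wcompile.
  by congr code_at; rewrite /=; lia.
Qed.

Lemma wcompile_correct code c s s' t : wrun c s s' t -> forall off,
  code_at code off (wcompile off c) -> mrun code t off s (off + wsize c) s'.
Proof.
elim=> {c s s' t}.
- move=> o s off /code_at_instr[lt_off E].
  by apply: mrun_step => //; rewrite E /= addn1; apply: mrun_stop.
- move=> c1 c2 s s1 s2 t1 t2 _ IH1 _ IH2 off at_off.
  have {}IH1 := IH1 _ (code_at_catl at_off).
  have := code_at_catr at_off; rewrite size_wcompile => /IH2.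
  by rewrite -addnA; apply: mrun_trans IH1.
- move=> b i f s s1 t stop _ IH off at_off.
  have [lt_off E] := code_at_instr at_off.
  apply: mrun_step => //; rewrite E /= -addn1.
  have := code_at_branch (head SB (s i)) at_off; rewrite (negbTE stop) -cats1 => at_r.
  apply: mrun_trans (IH _ (code_at_catl at_r)) _.
  have [] := code_at_instr (code_at_catr at_r); rewrite size_wcompile => lt_r Er.
  by apply: mrun_step => //; rewrite Er /=; apply: mrun_stop.
- move=> b i f s s1 s2 t1 t2 go _ IH1 _ IH2 off at_off.
  have [lt_off E] := code_at_instr at_off.
  apply: mrun_step => //; rewrite E /= -addnS.
  have := code_at_branch (head SB (s i)) at_off; rewrite go -cats1 => at_r.
  apply: mrun_trans (IH1 _ (code_at_catl at_r)) _.
  have [] := code_at_instr (code_at_catr at_r); rewrite size_wcompile => lt_r Er.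
  by apply: mrun_step => //; rewrite Er /=; apply: IH2.
Qed.

Lemma wcom_machine k c : 0 < k -> wcom_ok k c -> exists M : TM,
  forall x s t, SB \notin x -> wrun c (init_store x) s t ->
  halts_within M x (t * (3 * (size x + k + t) + 9)) (s 0).
Proof.
move=> k0 ok; exists (stack_machine k (wcompile 0 c)) => x s t nbx run.
apply: stack_machine_halts => //; first exact: wcompile_ok.
have := @wcompile_correct (wcompile 0 c) _ _ _ _ run 0.
rewrite add0n size_wcompile; apply.
by exists [::] => //; exists [::]; rewrite cats0.
Qed.

(** * A language with bounded loops *)

(* [CFor x f] runs [f a] for the symbols [a] that are on the stack [x] when the
   loop is entered, but only for the first [N] of them: the running time is
   then polynomial in [N] for every program. *)
Inductive com :=
  | CSkip
  | CPush of nat & sym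
  | CSnoc of nat & sym
  | CCase of nat & (sym -> com)
  | CSeq of com & com
  | CFor of nat & (sym -> com).

Section Exec.

Variable N : nat.

Fixpoint exec (c : com) (s : store) : store :=
  match c with
  | CSkip => s
  | CPush x a => if is_blank a then s else upd s x (a :: s x)
  | CSnoc x a => if is_blank a then s else upd s x (rcons (s x) a)
  | CCase x f => exec (f (head SB (s x))) (upd s x (behead (s x)))
  | CSeq c1 c2 => exec c2 (exec c1 s)
  | CFor x f => foldl (fun s a => exec (f a) s) s (take N (s x))
  end.

(** A bound that does not depend on the store. Branches are bounded by their sum; in a loop, 18 and
    15 add up the four transfers that prepare the list of symbols and the overhead of the main loop
    (4 + 3 + 5 + 4 + 2 per symbol, 3 for each of the five loops). *)
Fixpoint cost (c : com) : nat :=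
  match c with
  | CSkip | CPush _ _ | CSnoc _ _ => 1
  | CCase x f => 2 + (cost (f SB) + cost (f S0) + cost (f S1) + cost (f SSep))
  | CSeq c1 c2 => cost c1 + cost c2
  | CFor x f => 15 + N * 18 +
      N * (cost (f SB) + cost (f S0) + cost (f S1) + cost (f SSep))
  end.

End Exec.

Fixpoint com_ok (P : pred nat) (c : com) : bool :=
  match c with
  | CSkip => true
  | CPush x _ | CSnoc x _ => P x
  | CSeq c1 c2 => com_ok P c1 && com_ok P c2
  | CCase x f | CFor x f =>
    [&& P x, com_ok P (f SB), com_ok P (f S0), com_ok P (f S1)
      & com_ok P (f SSep)]
  end.

(** A loop reads the stack [x] without changing it, hence no condition on [x] in the last case. *)
Fixpoint keeps (v : nat) (c : com) : bool :=
  match c with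
  | CSkip => true
  | CPush x _ | CSnoc x _ => x != v
  | CSeq c1 c2 => keeps v c1 && keeps v c2
  | CCase x f => [&& x != v, keeps v (f SB), keeps v (f S0), keeps v (f S1)
                   & keeps v (f SSep)]
  | CFor x f => [&& keeps v (f SB), keeps v (f S0), keeps v (f S1)
                  & keeps v (f SSep)]
  end.

Fixpoint loop_depth (c : com) : nat :=
  match c with
  | CSkip | CPush _ _ | CSnoc _ _ => 0
  | CSeq c1 c2 => maxn (loop_depth c1) (loop_depth c2)
  | CCase x f => maxn (maxn (loop_depth (f SB)) (loop_depth (f S0)))
      (maxn (loop_depth (f S1)) (loop_depth (f SSep)))
  | CFor x f => (maxn (maxn (loop_depth (f SB)) (loop_depth (f S0)))
      (maxn (loop_depth (f S1)) (loop_depth (f SSep)))).+1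
  end.

(** * Stores and frame properties *)

Lemma upd_id s i : upd s i (s i) = s.
Proof. by apply: functional_extensionality => j; rewrite /upd; case: eqP => [->|]. Qed.

Lemma upd_idE s i v : s i = v -> upd s i v = s.
Proof. by move<-; apply: upd_id. Qed.

Lemma upd_upd s i u v : upd (upd s i u) i v = upd s i v.
Proof. by apply: functional_extensionality => j; rewrite /upd; case: eqP. Qed.

Lemma upd_updC s i j u v : i != j -> upd (upd s i u) j v = upd (upd s j v) i u.
Proof.
move=> ij; apply: functional_extensionality => l; rewrite /upd.
by case: eqP => // ->; rewrite eq_sym (negbTE ij).
Qed.

Lemma updE s i v : upd s i v i = v.
Proof. by rewrite /upd eqxx. Qed.

Lemma updN s i j v : j != i -> upd s i v j = s j.
Proof. by rewrite /upd => /negbTE->. Qed.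

Lemma com_ok_branch P x f r : com_ok P (CCase x f) -> com_ok P (f r).
Proof. by case/and5P=> _ *; case: r. Qed.

Lemma keeps_branch v x f r : keeps v (CFor x f) -> keeps v (f r).
Proof. by case/and4P=> *; case: r. Qed.

Lemma com_ok_keeps P v c : com_ok P c -> ~~ P v -> keeps v c.
Proof.
move=> ok vN; have neq x : P x -> x != v by apply: contraTneq => ->.
elim: c ok => //= [x _ /neq|x _ /neq|x f IH|c1 IH1 c2 IH2|x f IH] //.
- by case/and5P=> /neq-> /IH-> /IH-> /IH-> /IH->.
- by case/andP=> /IH1-> /IH2->.
- by case/and5P=> /neq _ /IH-> /IH-> /IH-> /IH->.
Qed.

Lemma exec_keeps N v c s : keeps v c -> exec N c s v = s v.
Proof.
elim: c s => //= [x a|x a|x f IH|c1 IH1 c2 IH2|x f IH] s.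
- by rewrite eq_sym => vx; case: is_blank => //; rewrite updN.
- by rewrite eq_sym => vx; case: is_blank => //; rewrite updN.
- case/andP=> vx K; rewrite IH; first by rewrite updN // eq_sym.
  exact: (keeps_branch (x := x)).
- by case/andP=> K1 K2; rewrite IH2 ?IH1.
- move=> K; move: (take N (s x)) => u; elim: u s => //= a u IHu s; rewrite IHu IH //.
  exact: (keeps_branch (x := x)).
Qed.

Lemma foldl_upd (F : store -> sym -> store) l w s v :
  (forall s a, F (upd s l w) a = upd (F s a) l w) ->
  foldl F (upd s l w) v = upd (foldl F s v) l w.
Proof. by move=> H; elim: v s => //= a v IHv s; rewrite H IHv. Qed.

(** The frame rule: a command commutes with any change of a stack that it never mentions. This hides
    the bookkeeping stacks of the compiler from the source program. *)
Lemma exec_upd N P c s l w : com_ok P c -> ~~ P l ->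
  exec N c (upd s l w) = upd (exec N c s) l w.
Proof.
move=> ok lN; have neq x : P x -> x != l by apply: contraTneq => ->.
elim: c s ok => //= [x a|x a|x f IH|c1 IH1 c2 IH2|x f IH] s.
- by move/neq=> xl; case: is_blank => //; rewrite updN // upd_updC // eq_sym.
- by move/neq=> xl; case: is_blank => //; rewrite updN // upd_updC // eq_sym.
- move=> ok; have /neq xl : P x by case/andP: ok.
  by rewrite updN // upd_updC ?IH ?(com_ok_branch _ ok) // eq_sym.
- by case/andP=> ok1 ok2; rewrite IH1 ?IH2.
- move=> ok; have /neq xl : P x by case/andP: ok.
  rewrite updN // foldl_upd // => s' a.
  by rewrite IH // (com_ok_branch _ ok).
Qed.

Lemma exec_nonblank N c s : nonblank s -> nonblank (exec N c s).
Proof.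
have nbU s' x v : nonblank s' -> SB \notin v -> nonblank (upd s' x v).
  by move=> nb vN i; rewrite /upd; case: eqP.
elim: c s => //= [x a|x a|x f IH|c1 IH1 c2 IH2|x f IH] s nb.
- case: ifPn => // a0; apply: nbU => //.
  by rewrite in_cons negb_or nb andbT eq_sym -is_blankE.
- case: ifPn => // a0; apply: nbU => //.
  by rewrite mem_rcons in_cons negb_or nb andbT eq_sym -is_blankE.
- by apply/IH/nbU => //; apply: contra (nb x) => /mem_behead.
- by apply/IH2/IH1.
- by move: (take N (s x)) => u; elim: u s nb => //= a u IHu s nb; apply/IHu/IH.
Qed.

Definition wwhile i (g : sym -> wcom) :=
  WBr true i (fun r => if is_blank r then WOp Nop else g r).

Lemma wwhile_nil i g s : s i = [::] -> wrun (wwhile i g) s s 3.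
Proof.
move=> si; have E : s = (op_sem Nop (upd s i (behead (s i)))).1.
  by rewrite /= upd_idE // si.
by rewrite {2}E; apply: wrun_exit; rewrite si //=; apply: wrun_op.
Qed.

Lemma wwhile_cons i g s a v s1 s2 t1 t2 : s i = a :: v -> ~~ is_blank a ->
  wrun (g a) (upd s i v) s1 t1 -> wrun (wwhile i g) s1 s2 t2 ->
  wrun (wwhile i g) s s2 (t1 + t2).+2.
Proof.
move=> si a0 R1 R2; apply: wrun_loop R2; first by rewrite si.
by rewrite si /= (negbTE a0).
Qed.

(** A pop from an empty stack yields [SB]; passing that on must leave the target unchanged. *)
Definition push_op i a := if is_blank a then Nop else PushF i a.
Definition snoc_op i a := if is_blank a then Nop else PushB i a.

Ltac upds := rewrite /upd; do ?[case: eqP => ? //]; try lia; try done.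

Ltac store_eq :=
  let v := fresh "v" in apply: functional_extensionality => v; rewrite /upd;
  do ?[case: eqP => ? //]; try subst v; try lia; try done.

(* User variables are the stacks below [V]; [V] holds [N] in unary, [V.+1] and
   [V.+2] are scratch, and [V.+3 + d] holds the symbols still to be treated by
   the loop at nesting depth [d]. *)
Section Compile.

Variable V : nat.

(** A loop duplicates the counter [N] and restores it, then uses one copy to pop at most [N] symbols
    of [x] onto [V.+1]. These are in reverse order, so popping them again restores [x] and fills the
    private list in the right order. The body may then modify [x] freely. *)
Fixpoint compile (d : nat) (c : com) : wcom :=
  match c with
  | CSkip => WOp Nop
  | CPush x a => WOp (push_op x a)
  | CSnoc x a => WOp (snoc_op x a)
  | CCase x f => WBr false x (fun r => compile d (f r))
  | CSeq c1 c2 => WSeq (compile d c1) (compile d c2)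
  | CFor x f =>
    WSeq (wwhile V (fun _ => WSeq (WOp (PushF V.+1 S1)) (WOp (PushF V.+2 S1))))
    (WSeq (wwhile V.+1 (fun _ => WOp (PushF V S1)))
    (WSeq (wwhile V.+2 (fun _ => WBr false x (fun a => WOp (push_op V.+1 a))))
    (WSeq (wwhile V.+1 (fun a =>
             WSeq (WOp (push_op x a)) (WOp (push_op (V.+3 + d) a))))
          (wwhile (V.+3 + d) (fun a => compile d.+1 (f a))))))
  end.

Lemma compile_ok k d c : com_ok (fun x => x < V) c ->
  V.+3 + d + loop_depth c <= k -> wcom_ok k (compile d c).
Proof.
have ok_push i a : i < k -> op_ok k (push_op i a).
  by move=> ik; rewrite /push_op; case: ifP => //= ->; rewrite ik.
have ok_snoc i a : i < k -> op_ok k (snoc_op i a).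
  by move=> ik; rewrite /snoc_op; case: ifP => //= ->; rewrite ik.
elim: c d => [|x a|x a|x f IH|c1 IH1 c2 IH2|x f IH] d //=.
- by move=> xV le_k; apply: ok_push; lia.
- by move=> xV le_k; apply: ok_snoc; lia.
- case/and5P=> xV ok1 ok2 ok3 ok4 le_k.
  by rewrite !IH ?andbT //; lia.
- by case/andP=> ok1 ok2 le_k; rewrite IH1 ?IH2 //; lia.
case/and5P=> xV ok1 ok2 ok3 ok4 le_k.
have -> : V < k by lia.
have -> : V.+1 < k by lia.
have -> : V.+2 < k by lia.
have -> : V.+3 + d < k by lia.
have -> : x < k by lia.
by rewrite !IH //; lia.
Qed.

(** Lists of depth below [d] belong to the enclosing loops and may be non-empty. *)
Definition ready N d (s : store) :=
  [/\ s V = nseq N S1, s V.+1 = [::], s V.+2 = [::]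
    & forall e, d <= e -> s (V.+3 + e) = [::]].

Lemma ready_exec N d c s : com_ok (fun x => x < V) c ->
  ready N d s -> ready N d (exec N c s).
Proof.
move=> ok [sV sV1 sV2 sl]; have K i : V <= i -> exec N c s i = s i.
  by move=> Vi; apply: exec_keeps; apply: com_ok_keeps ok _; rewrite -leqNgt.
by split=> [|||e de]; rewrite K ?sl //; lia.
Qed.

Lemma cat_nseqS n (a : sym) v : nseq n a ++ a :: v = a :: nseq n a ++ v.
Proof. by elim: n => //= n ->. Qed.

Lemma wwhile_transfer n s i j k : i < j -> j < k -> s i = nseq n S1 ->
  wrun (wwhile i (fun _ => WSeq (WOp (PushF j S1)) (WOp (PushF k S1)))) s
    (upd (upd (upd s i [::]) j (nseq n S1 ++ s j)) k (nseq n S1 ++ s k))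
    (n * 4 + 3).
Proof.
move=> ij jk; elim: n s => [|n IHn] s si.
  by rewrite /= [upd s i _]upd_idE // !upd_id; exact: wwhile_nil.
set s1 := upd (upd (upd s i (nseq n S1)) j (S1 :: s j)) k (S1 :: s k).
have R : wrun (WSeq (WOp (PushF j S1)) (WOp (PushF k S1)))
    (upd s i (nseq n S1)) s1 (1 + 1).
  have := wrun_seq (wrun_op (PushF j S1) (upd s i (nseq n S1))) (wrun_op (PushF k S1) _).
  by rewrite /= !updN; try lia.
have s1i : s1 i = nseq n S1 by rewrite /s1; upds.
have := wwhile_cons si isT R (IHn s1 s1i).
have -> : (1 + 1 + (n * 4 + 3)).+2 = n.+1 * 4 + 3 by lia.
congr (wrun _ _ _ _); rewrite /s1 !updE updN ?updE; try lia.
by store_eq; rewrite cat_nseqS.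
Qed.

Lemma wwhile_restore n s i j : i < j -> s j = nseq n S1 ->
  wrun (wwhile j (fun _ => WOp (PushF i S1))) s
    (upd (upd s j [::]) i (nseq n S1 ++ s i)) (n * 3 + 3).
Proof.
move=> ij; elim: n s => [|n IHn] s sj.
  by rewrite /= [upd s j _]upd_idE // !upd_id; exact: wwhile_nil.
set s1 := upd (upd s j (nseq n S1)) i (S1 :: s i).
have R : wrun (WOp (PushF i S1)) (upd s j (nseq n S1)) s1 1.
  have := wrun_op (PushF i S1) (upd s j (nseq n S1)).
  by rewrite /= !updN; try lia.
have s1j : s1 j = nseq n S1 by rewrite /s1; upds.
have := wwhile_cons sj isT R (IHn s1 s1j).
have -> : (1 + (n * 3 + 3)).+2 = n.+1 * 3 + 3 by lia.
congr (wrun _ _ _ _); rewrite /s1 !updE.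
by store_eq; rewrite cat_nseqS.
Qed.

Lemma wwhile_take n s x i j : x < i -> i < j -> s j = nseq n S1 ->
  nonblank s ->
  wrun (wwhile j (fun _ => WBr false x (fun a => WOp (push_op i a)))) s
    (upd (upd (upd s j [::]) x (drop n (s x))) i (rev (take n (s x)) ++ s i))
    (n * 5 + 3).
Proof.
move=> xi ij; elim: n s => [|n IHn] s sj nb.
  by rewrite drop0 take0 /= [upd s j _]upd_idE // !upd_id; exact: wwhile_nil.
set s1 := upd (upd (upd s j (nseq n S1)) x (behead (s x))) i
  (if s x is a :: _ then a :: s i else s i).
have R : wrun (WBr false x (fun a => WOp (push_op i a))) (upd s j (nseq n S1)) s1 3.
  have := @wrun_exit false x (fun a => WOp (push_op i a)) (upd s j (nseq n S1)).
  move=> /(_ _ _ isT (wrun_op _ _)); congr (wrun _ _ _ _).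
  rewrite /s1 [upd s j _ x]updN; try lia.
  case sx: (s x) => [|a v] /=.
    by store_eq.
  have a0 : is_blank a = false.
    by have := nb x; rewrite sx in_cons negb_or is_blankE eq_sym => /andP[/negbTE].
  by rewrite /push_op a0 /=; store_eq.
have s1j : s1 j = nseq n S1 by rewrite /s1; upds.
have nb1 : nonblank s1.
  move=> l; rewrite /s1 /upd; have nbx := nb x; have nbi := nb i.
  case: eqP => _; [|case: eqP => _; [|case: eqP => _ //]].
  - case: (s x) nbx => [|a v] //; rewrite !in_cons !negb_or.
    by case/andP=> -> _; rewrite nbi.
  - by apply: contra nbx => /mem_behead.
  - by rewrite mem_nseq andbF.
have := wwhile_cons sj isT R (IHn s1 s1j nb1).
have -> : (3 + (n * 5 + 3)).+2 = n.+1 * 5 + 3 by lia.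
have -> : s1 x = behead (s x) by rewrite /s1 updN ?updE; try lia.
have -> : s1 i = if s x is a :: _ then a :: s i else s i by rewrite /s1 updE.
congr (wrun _ _ _ _); rewrite /s1; case: (s x) => [|a v] /=.
  by store_eq.
by store_eq; rewrite rev_cons cat_rcons.
Qed.

Lemma wwhile_unload w s x i l : x < i -> i < l -> s i = rev w -> SB \notin w ->
  wrun (wwhile i (fun a => WSeq (WOp (push_op x a)) (WOp (push_op l a)))) s
    (upd (upd (upd s i [::]) x (w ++ s x)) l (w ++ s l)) (size w * 4 + 3).
Proof.
move=> xi il; elim/last_ind: w s => [|w a IHw] s si nb.
  by rewrite /= [upd s i _]upd_idE // !upd_id; exact: wwhile_nil.
move: nb; rewrite mem_rcons in_cons negb_or => /andP[a0 nb].
have {}a0 : ~~ is_blank a by rewrite is_blankE eq_sym.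
rewrite rev_rcons in si.
set s1 := upd (upd (upd s i (rev w)) x (a :: s x)) l (a :: s l).
have R : wrun (WSeq (WOp (push_op x a)) (WOp (push_op l a)))
    (upd s i (rev w)) s1 (1 + 1).
  have := wrun_seq (wrun_op (push_op x a) (upd s i (rev w))) (wrun_op (push_op l a) _).
  by rewrite /push_op (negbTE a0) /= !updN; try lia.
have s1i : s1 i = rev w by rewrite /s1; upds.
have := wwhile_cons si a0 R (IHw s1 s1i nb).
have -> : (1 + 1 + (size w * 4 + 3)).+2 = size (rcons w a) * 4 + 3.
  by rewrite size_rcons; lia.
congr (wrun _ _ _ _); rewrite /s1 !updE [upd _ l _ x]updN ?updE; try lia.
by store_eq; rewrite cat_rcons.
Qed.

Lemma compile_correct N d c s : com_ok (fun x => x < V) c -> nonblank s ->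
  ready N d s ->
  exists2 t, t <= cost N c & wrun (compile d c) s (exec N c s) t.
Proof.
elim: c d s => [|x a|x a|x f IH|c1 IH1 c2 IH2|x f IH] d s ok nb rdy.
- by exists 1 => //; apply: (wrun_op Nop).
- exists 1 => //=; rewrite /push_op; case: is_blank; first exact: (wrun_op Nop).
  exact: (wrun_op (PushF x a)).
- exists 1 => //=; rewrite /snoc_op; case: is_blank; first exact: (wrun_op Nop).
  exact: (wrun_op (PushB x a)).
- have xV : x < V by case/andP: ok.
  have nb' : nonblank (upd s x (behead (s x))).
    exact: (@op_sem_nonblank V (Pop x)).
  have rdy' : ready N d (upd s x (behead (s x))).
    by case: rdy => *; split=> *; rewrite updN ?H2; try lia; auto.
  have [t le_t R] := IH (head SB (s x)) d _ (com_ok_branch _ ok) nb' rdy'.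
  exists t.+2; last exact: wrun_exit R.
  by move: le_t => /=; case: (head _ _); lia.
- case/andP: ok => ok1 ok2.
  have [t1 le1 R1] := IH1 d s ok1 nb rdy.
  have [t2 le2 R2] := IH2 d _ ok2 (exec_nonblank N c1 nb) (ready_exec ok1 rdy).
  by exists (t1 + t2); [rewrite leq_add | apply: wrun_seq R1 R2].
have xV : x < V by case/andP: ok.
set l := V.+3 + d; set F := fun s a => exec N (f a) s.
set C := cost N (f SB) + cost N (f S0) + cost N (f S1) + cost N (f SSep).
(* The main loop, by induction on the private list, which the body cannot touch. *)
have loop w s' : nonblank s' -> ready N d.+1 s' -> s' l = w ->
    exists2 t, t <= size w * (C + 2) + 3 &
    wrun (wwhile l (fun a => compile d.+1 (f a))) s' (upd (foldl F s' w) l [::]) t.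
  elim: w s' => [|a w IHw] s' nb' rdy' sl.
    by exists 3 => //=; rewrite upd_idE //; apply: wwhile_nil.
  have a0 : ~~ is_blank a.
    by have := nb' l; rewrite sl in_cons negb_or is_blankE eq_sym => /andP[].
  have ok_a : com_ok (fun x => x < V) (f a) by apply: com_ok_branch ok.
  have nbw : nonblank (upd s' l w).
    have -> : upd s' l w = (op_sem (Pop l) s').1 by rewrite /= sl.
    exact: (@op_sem_nonblank l.+1 (Pop l) _ (leqnn _)).
  have rdyw : ready N d.+1 (upd s' l w).
    by rewrite /l; case: rdy' => ? ? ? H2; split=> *; rewrite updN ?H2; try lia; auto.
  have [t1 le1 R1] := IH a d.+1 _ ok_a nbw rdyw.
  have ups u : F (upd u l w) a = upd (F u a) l w.
    by apply: exec_upd ok_a _; rewrite /l; lia.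
  rewrite -/(F _ _) ups in R1.
  have nb1 : nonblank (upd (F s' a) l w) by rewrite -ups; apply: exec_nonblank.
  have rdy1 : ready N d.+1 (upd (F s' a) l w) by rewrite -ups; apply: ready_exec.
  have [t2 le2 R2] := IHw _ nb1 rdy1 (updE _ _ _).
  rewrite foldl_upd ?upd_upd in R2; last first.
    move=> u b; apply: exec_upd; first exact: com_ok_branch ok.
    by rewrite /l; lia.
  exists (t1 + t2).+2; last exact: wwhile_cons sl a0 R1 R2.
  have : t1 <= C by move: le1; rewrite /C; case: (a); lia.
  by rewrite /=; lia.
case: (rdy) => sV sV1 sV2 sl.
have R1 := wwhile_transfer (ltnSn V) (ltnSn V.+1) sV.
rewrite sV1 sV2 !cats0 in R1; set s1 := upd _ V.+2 _ in R1.
have s1V1 : s1 V.+1 = nseq N S1 by rewrite /s1 updN ?updE; try lia.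
have R2 := wwhile_restore (ltnSn V) s1V1.
have s1V : s1 V = [::] by rewrite /s1; upds.
rewrite s1V cats0 in R2.
have s2E : upd (upd s1 V.+1 [::]) V (nseq N S1) = upd s V.+2 (nseq N S1).
  by rewrite /s1; store_eq.
rewrite s2E in R2; set s2 := upd s V.+2 _ in R2.
have s2V2 : s2 V.+2 = nseq N S1 by rewrite /s2 updE.
have nb2 : nonblank s2.
  by move=> i; rewrite /s2 /upd; case: eqP => // _; rewrite mem_nseq andbF.
have R3 := @wwhile_take N s2 x V.+1 V.+2 (ltnW xV) (ltnSn _) s2V2 nb2.
have s2x : s2 x = s x by rewrite /s2 updN //; lia.
have s2V1 : s2 V.+1 = [::] by rewrite /s2 updN ?sV1; try lia.
rewrite s2x s2V1 cats0 in R3; set s3 := upd _ V.+1 _ in R3.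
set w := take N (s x) in s3 R3.
have s3V1 : s3 V.+1 = rev w by rewrite /s3 updE.
have nbw : SB \notin w by apply: contra (nb x); apply: mem_take.
have R4 := @wwhile_unload w s3 x V.+1 l (ltnW xV) _ s3V1 nbw.
have {}R4 := R4 ltac:(rewrite /l; lia).
have s3x : s3 x = drop N (s x) by rewrite /s3 updN ?updE; try lia.
have s3l : s3 l = [::] by rewrite /s3 /s2 /l !updN ?sl; try lia.
rewrite s3x s3l cats0 cat_take_drop in R4.
have s4E : upd (upd (upd s3 V.+1 [::]) x (s x)) l w = upd s l w.
  by rewrite /s3 /s2 /l; store_eq.
rewrite s4E in R4.
have nb4 : nonblank (upd s l w) by move=> i; rewrite /upd; case: eqP.
have rdy4 : ready N d.+1 (upd s l w).
  by rewrite /l; split=> *; rewrite updN ?sl; try lia; auto.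
have [t le_t R5] := loop w _ nb4 rdy4 (updE _ _ _).
(* The private list is empty in [s] and ignored by the bodies, so filling it at first and emptying
   it at last leaves no trace. *)
have foldE : upd (foldl F (upd s l w) w) l [::] = exec N (CFor x f) s.
  rewrite foldl_upd ?upd_upd; last first.
    move=> u b; apply: exec_upd; first exact: com_ok_branch ok.
    by rewrite /l; lia.
  apply: upd_idE; rewrite -[foldl _ _ _]/(exec N (CFor x f) s) exec_keeps ?sl //.
  by apply: com_ok_keeps ok _; rewrite /l; lia.
rewrite foldE in R5.
exists (N * 4 + 3 + (N * 3 + 3 + (N * 5 + 3 + (size w * 4 + 3 + t)))).
  have : size w <= N by rewrite size_take_min geq_minl.
  by move: le_t; rewrite /= -/C; nia.
exact: wrun_seq R1 (wrun_seq R2 (wrun_seq R3 (wrun_seq R4 R5))).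
Qed.

End Compile.

(** * Polynomial running time *)

(** With [n.+1] instead of [n] the powers are monotone in the exponent also at [n = 0], which makes
    the class closed under sums and products. *)
Definition poly_bounded (f : nat -> nat) :=
  exists a e, forall n, f n <= a * n.+1 ^ e.

Lemma poly_const c : poly_bounded (fun _ => c).
Proof. by exists c, 0 => n; rewrite expn0 muln1. Qed.

Lemma poly_id : poly_bounded id.
Proof. by exists 1, 1 => n; rewrite mul1n expn1. Qed.

Lemma poly_add f g :
  poly_bounded f -> poly_bounded g -> poly_bounded (fun n => f n + g n).
Proof.
move=> [a [e Hf]] [b [e' Hg]]; exists (a + b), (e + e') => n.
rewrite mulnDl leq_add //.
- by apply: leq_trans (Hf n) _; rewrite leq_mul2l leq_pexp2l ?leq_addr ?orbT.
- by apply: leq_trans (Hg n) _; rewrite leq_mul2l leq_pexp2l ?leq_addl ?orbT.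
Qed.

Lemma poly_mul f g :
  poly_bounded f -> poly_bounded g -> poly_bounded (fun n => f n * g n).
Proof.
move=> [a [e Hf]] [b [e' Hg]]; exists (a * b), (e + e') => n.
by rewrite expnD mulnACA leq_mul.
Qed.

Lemma leq_expl m n e : m <= n -> m ^ e <= n ^ e.
Proof. by case: e => // e le_mn; rewrite leq_exp2r. Qed.

Lemma poly_shift f c : poly_bounded f -> poly_bounded (fun n => f (n + c)).
Proof.
move=> [a [e Hf]]; exists (a * c.+1 ^ e), e => n.
apply: leq_trans (Hf _) _; rewrite -mulnA leq_mul2l -expnMn leq_expl ?orbT //.
by nia.
Qed.

(** For positive [n] one has [n.+1 <= 2 * n], and the additive constant takes care of [n = 0]. *)
Lemma poly_monomial f : poly_bounded f ->
  exists a e, forall n, f n <= a * n ^ e + a.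
Proof.
move=> [a [e Hf]]; exists (a * 2 ^ e), e => n; apply: leq_trans (Hf n) _.
case: n => [|n].
  by rewrite exp1n muln1; apply: leq_trans (leq_addl _ _); rewrite leq_pmulr ?expn_gt0.
apply: leq_trans (leq_addr _ _); rewrite -mulnA leq_mul2l -expnMn.
by rewrite leq_expl ?orbT //; lia.
Qed.

Lemma poly_cost c : poly_bounded (fun N => cost N c).
Proof.
have P4 (f : sym -> com) : (forall r, poly_bounded (fun N => cost N (f r))) ->
    poly_bounded (fun N => cost N (f SB) + cost N (f S0) + cost N (f S1) + cost N (f SSep)).
  by move=> H; do 3 apply: poly_add => //.
elim: c => [|x a|x a|x f IH|c1 IH1 c2 IH2|x f IH] /=; try exact: poly_const.
- by apply: poly_add (poly_const 2) _; apply: P4.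
- exact: poly_add.
- apply: poly_add; last exact: poly_mul poly_id (P4 _ IH).
  exact: poly_add (poly_const 15) (poly_mul poly_id (poly_const 18)).
Qed.

(** * Computing the loop bound from the input *)

Section Prelude.

Variables (V c0 : nat).
Hypothesis V0 : 0 < V.

(** The input is poured onto a scratch stack while its length is counted in unary on [V], and poured
    back; the constant [c0] is added to that count. *)
Definition prelude : wcom :=
  WSeq (wwhile 0 (fun a => WSeq (WOp (push_op V.+1 a)) (WOp (PushF V S1))))
  (WSeq (wwhile V.+1 (fun a => WOp (push_op 0 a)))
  (iter c0 (WSeq (WOp (PushF V S1))) (WOp Nop))).

Lemma prelude_ok k : V.+2 <= k -> wcom_ok k prelude.
Proof.
move=> Vk; rewrite /= !andbT.
have -> : V < k by lia.
have -> : V.+1 < k by lia.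
have -> : 0 < k by lia.
by elim: (c0) => //= n ->; rewrite andbT; lia.
Qed.

Lemma prelude_run x : SB \notin x ->
  wrun prelude (init_store x) (upd (init_store x) V (nseq (size x + c0) S1))
    (size x * 4 + 3 + (size x * 3 + 3 + c0.+1)).
Proof.
move=> nbx.
have R1 u s : SB \notin u -> s 0 = u ->
    wrun (wwhile 0 (fun a => WSeq (WOp (push_op V.+1 a)) (WOp (PushF V S1)))) s
    (upd (upd (upd s 0 [::]) V.+1 (rev u ++ s V.+1)) V (nseq (size u) S1 ++ s V))
    (size u * 4 + 3).
  elim: u s => [|a u IHu] s nb s0.
    by rewrite /= [upd s 0 _]upd_idE // !upd_id; exact: wwhile_nil.
  move: nb; rewrite in_cons negb_or => /andP[a0 nb].
  have {}a0 : ~~ is_blank a by rewrite is_blankE eq_sym.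
  set s1 := upd (upd (upd s 0 u) V.+1 (a :: s V.+1)) V (S1 :: s V).
  have R : wrun (WSeq (WOp (push_op V.+1 a)) (WOp (PushF V S1))) (upd s 0 u) s1 (1 + 1).
    have := wrun_seq (wrun_op (push_op V.+1 a) (upd s 0 u)) (wrun_op (PushF V S1) _).
    by rewrite /push_op (negbTE a0) /= !updN; try lia.
  have s10 : s1 0 = u by rewrite /s1; upds.
  have := wwhile_cons s0 a0 R (IHu s1 nb s10).
  have -> : (1 + 1 + (size u * 4 + 3)).+2 = (size (a :: u)) * 4 + 3 by rewrite /=; lia.
  congr (wrun _ _ _ _); rewrite /s1 !updE [upd _ V _ V.+1]updN ?updE; try lia.
  store_eq; first by rewrite cat_nseqS.
  by rewrite rev_cons cat_rcons.
have R2 u s : SB \notin u -> s V.+1 = u ->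
    wrun (wwhile V.+1 (fun a => WOp (push_op 0 a))) s
    (upd (upd s V.+1 [::]) 0 (rev u ++ s 0)) (size u * 3 + 3).
  elim: u s => [|a u IHu] s nb s0.
    by rewrite /= [upd s _ _]upd_idE // !upd_id; exact: wwhile_nil.
  move: nb; rewrite in_cons negb_or => /andP[a0 nb].
  have {}a0 : ~~ is_blank a by rewrite is_blankE eq_sym.
  set s1 := upd (upd s V.+1 u) 0 (a :: s 0).
  have R : wrun (WOp (push_op 0 a)) (upd s V.+1 u) s1 1.
    have := wrun_op (push_op 0 a) (upd s V.+1 u).
    by rewrite /push_op (negbTE a0) /= !updN; try lia.
  have s10 : s1 V.+1 = u by rewrite /s1; upds.
  have := wwhile_cons s0 a0 R (IHu s1 nb s10).
  have -> : (1 + (size u * 3 + 3)).+2 = (size (a :: u)) * 3 + 3 by rewrite /=; lia.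
  congr (wrun _ _ _ _); rewrite /s1 !updE.
  by store_eq; rewrite rev_cons cat_rcons.
have R3 n s : wrun (iter n (WSeq (WOp (PushF V S1))) (WOp Nop)) s
    (upd s V (nseq n S1 ++ s V)) n.+1.
  elim: n s => [|n IHn] s; first by rewrite /= upd_id; apply: (wrun_op Nop).
  have := wrun_seq (wrun_op (PushF V S1) s) (IHn _).
  rewrite add1n; congr (wrun _ _ _ _) => /=.
  by rewrite updE; store_eq; rewrite cat_nseqS.
have {}R1 := R1 x (init_store x) nbx (updE _ _ _).
set s1 := upd _ V _ in R1.
have s1V : s1 V.+1 = rev x.
  by rewrite /s1 updN ?updE /init_store; try lia; rewrite updN // cats0.
have {}R2 := R2 (rev x) s1 _ s1V; rewrite mem_rev revK size_rev in R2.
have {}R2 := R2 nbx; have {}R3 := R3 c0 (upd (upd s1 V.+1 [::]) 0 (x ++ s1 0)).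
have := wrun_seq R1 (wrun_seq R2 R3); congr (wrun _ _ _ _).
rewrite [upd _ 0 _ V]updN; last by lia.
rewrite [upd _ V.+1 _ V]updN; last by lia.
have -> : s1 V = nseq (size x) S1 ++ init_store x V by rewrite /s1 updE.
have -> : init_store x V = [::] by rewrite /init_store updN //; lia.
have -> : s1 0 = [::] by rewrite /s1; upds.
rewrite !cats0 -nseqD addnC /s1 /init_store.
by store_eq.
Qed.

Lemma com_machine c : com_ok (fun x => x < V) c ->
  exists (M : TM) a e, forall x, SB \notin x ->
  halts_within M x (a * size x ^ e + a) (exec (size x + c0) c (init_store x) 0).
Proof.
move=> ok; pose k := V.+3 + loop_depth c.
have ok_w : wcom_ok k (WSeq prelude (compile V 0 c)).
  by apply/andP; split; [apply: prelude_ok | apply: compile_ok]; rewrite // /k; lia.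
have [M HM] := wcom_machine (ltac:(lia) : 0 < k) ok_w.
pose T n := n * 4 + 3 + (n * 3 + 3 + c0.+1) + cost (n + c0) c.
have PT : poly_bounded T.
  apply: poly_add; last exact: poly_shift (poly_cost c).
  have P3 := poly_const 3; have PI := poly_id.
  apply: poly_add; first exact: poly_add (poly_mul PI (poly_const 4)) P3.
  apply: poly_add (poly_const _); exact: poly_add (poly_mul PI P3) P3.
have [a [e Hae]] : exists a e, forall n, T n * (3 * (n + k + T n) + 9) <= a * n ^ e + a.
  apply: poly_monomial; apply: poly_mul => //; apply: poly_add (poly_const 9).
  apply: poly_mul (poly_const 3) _; apply: poly_add => //.
  exact: poly_add poly_id (poly_const k).
exists M, a, e => x nbx.
have nb0 : nonblank (init_store x).
  by move=> i; rewrite /init_store /upd; case: eqP.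
set s0 := upd (init_store x) V (nseq (size x + c0) S1).
have nb1 : nonblank s0.
  by move=> i; rewrite /s0 /upd; case: eqP => // _; rewrite mem_nseq andbF.
have rdy : ready V (size x + c0) 0 s0.
  split=> [|||i _]; rewrite /s0 /init_store ?updE //; by rewrite !updN //; lia.
have [t le_t R] := compile_correct ok nb1 rdy.
have [t' le' [halt out]] := HM x _ _ nbx (wrun_seq (prelude_run nbx) R).
(* The counter lies outside the variables of [c], so the frame rule removes it. *)
have outE : exec (size x + c0) c s0 0 = exec (size x + c0) c (init_store x) 0.
  by rewrite /s0 (exec_upd _ _ _ ok) ?ltnn // updN //; lia.
rewrite -outE; exists t' => //; apply: leq_trans le' (leq_trans _ (Hae (size x))).
have : size x * 4 + 3 + (size x * 3 + 3 + c0.+1) + t <= T (size x) by rewrite leq_add2l.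
move: (_ + t) (T (size x)) => u v uv; apply: leq_mul => //.
by rewrite leq_add2r leq_mul2l leq_add2l.
Qed.

End Prelude.

(** * Derived commands *)

Definition bit_word (w : seq sym) := all (fun a => (a == S0) || (a == S1)) w.

Definition enc_words (ws : seq (seq sym)) := flatten [seq w ++ [:: SSep] | w <- ws].

Lemma bit_word_nonblank w : bit_word w -> SB \notin w.
Proof. by move=> bw; apply/negP => /(allP bw). Qed.

Lemma enc_words_nonblank ws : all bit_word ws -> SB \notin enc_words ws.
Proof.
rewrite /enc_words; elim: ws => //= w ws IHws /andP[bw /IHws nb].
by rewrite !mem_cat !negb_or (bit_word_nonblank bw) nb.
Qed.

Definition copy x y := CFor x (fun a => CSnoc y a).

Definition clear x := CFor x (fun _ => CCase x (fun _ => CSkip)).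

Notation vX := 11 (only parsing).
Notation vE := 12 (only parsing).

(** A copy of [y] is consumed along [x], with a mark on [vE] for each mismatch; when [y] is too
    short the popped [SB] mismatches, and when it is too long something is left on [vX]. All scratch
    is empty again before [c] runs. *)
Definition if_eq x y c :=
  CSeq (copy y vX)
  (CSeq (CFor x (fun a => CCase vX (fun b => if b == a then CSkip else CPush vE S1)))
  (CSeq (CCase vX (fun b => if is_blank b then CSkip else CPush vE S1))
  (CSeq (clear vX)
        (CCase vE (fun b => if is_blank b then c else clear vE))))).

(** Here [vE] gets a mark for each symbol of [x] beyond the length of [y]. *)
Definition if_longer x y c :=
  CSeq (copy y vX)
  (CSeq (CFor x (fun _ => CCase vX (fun b => if is_blank b then CPush vE S1 else CSkip)))
  (CSeq (clear vX)
        (CCase vE (fun b => if is_blank b then CSkip else CSeq (clear vE) c)))).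

Definition for_words x w c :=
  CFor x (fun a => match a with
    | SSep => CSeq c (clear w)
    | SB => CSkip
    | _ => CSnoc w a
    end).

(* [x] holds a number in binary, least significant bit first; the stack [p]
   holds the current power of two in unary. *)
Definition to_unary x y p :=
  CSeq (CPush p S1)
    (CFor x (fun a => CSeq (if a == S1 then copy p y else CSkip) (copy p p))).

Definition bits_value (w : seq sym) := foldr (fun a v => (a == S1) + v.*2) 0 w.

Section Macros.

Variable N : nat.

Lemma exec_seq c1 c2 s : exec N (CSeq c1 c2) s = exec N c2 (exec N c1 s).
Proof. by []. Qed.

Lemma exec_case x f s :
  exec N (CCase x f) s = exec N (f (head SB (s x))) (upd s x (behead (s x))).
Proof. by []. Qed.

Lemma exec_for x f s :
  exec N (CFor x f) s = foldl (fun s a => exec N (f a) s) s (take N (s x)).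
Proof. by []. Qed.

Lemma exec_copy_trunc x y s : SB \notin s x ->
  exec N (copy x y) s = upd s y (s y ++ take N (s x)).
Proof.
move=> nb; have : SB \notin take N (s x) by apply: contra nb; apply: mem_take.
rewrite /=; move: (take N (s x)) => u; elim: u s {nb} => [|a u IHu] s.
  by rewrite cats0 upd_id.
rewrite in_cons negb_or eq_sym => /andP[a0 nb] /=.
by rewrite is_blankE (negbTE a0) IHu // updE upd_upd cat_rcons.
Qed.

Lemma exec_copy x y s : size (s x) <= N -> SB \notin s x ->
  exec N (copy x y) s = upd s y (s y ++ s x).
Proof. by move=> le_N nb; rewrite exec_copy_trunc // take_oversize. Qed.

Lemma exec_clear x s : size (s x) <= N -> exec N (clear x) s = upd s x [::].
Proof.
move=> le_N; rewrite /= take_oversize //.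
have H (u : seq sym) s' : foldl (fun s a => upd s x (behead (s x))) s' u =
    upd s' x (drop (size u) (s' x)); last by rewrite H drop_size.
elim: u s' => [|a u IHu] s' /=; first by rewrite drop0 upd_id.
by rewrite IHu updE upd_upd; case: (s' x).
Qed.

(** The number of marks is bounded as well, so that [clear] can remove them within [N] rounds. *)
Lemma if_eq_loop u v e s : SB \notin u ->
  exists2 e', e' <= e + size u & 
  foldl (fun s a => exec N (CCase vX (fun b => if b == a then CSkip else CPush vE S1)) s)
    (upd (upd s vX v) vE (nseq e S1)) u =
    upd (upd s vX (drop (size u) v)) vE (nseq e' S1) /\
  (e' == 0) = (e == 0) && (take (size u) v == u).
Proof.
elim: u v e => [|a u IHu] v e /=.
  by exists e; rewrite ?addn0 // drop0 take0 eqxx andbT.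
rewrite in_cons negb_or => /andP[a0 nb].
have -> : upd (upd s vX v) vE (nseq e S1) vX = v by upds.
have -> : upd (upd (upd s vX v) vE (nseq e S1)) vX (behead v) =
    upd (upd s vX (behead v)) vE (nseq e S1) by store_eq.
case: eqP => [hv|hv].
  have [e' le_e' [-> eE]] := IHu (behead v) e nb.
  exists e' => //; first by rewrite addnS ltnW.
  case: v hv eE => [|b v] /= hv; first by rewrite hv eqxx in a0.
  by rewrite hv eqseq_cons eqxx.
rewrite /= updE.
have -> : upd (upd (upd s vX (behead v)) vE (nseq e S1)) vE (S1 :: nseq e S1) =
    upd (upd s vX (behead v)) vE (nseq e.+1 S1) by store_eq.
have [e' le_e' [-> eE]] := IHu (behead v) e.+1 nb.
exists e'; first by rewrite addnS -addSn.
case: v hv eE => [|b v] /= hv -> /=; first by split=> //; rewrite andbF.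
by split=> //; rewrite eqseq_cons; move/eqP/negbTE: hv => ->; rewrite andbF.
Qed.

Lemma exec_if_eq x y c s : x != vX -> x != vE ->
  s vX = [::] -> s vE = [::] -> size (s x) < N -> size (s y) <= N ->
  SB \notin s x -> SB \notin s y ->
  exec N (if_eq x y c) s = if s x == s y then exec N c s else s.
Proof.
move=> xX xE sX sE lx ly nbx nby.
rewrite /if_eq !exec_seq exec_copy // sX cat0s exec_for.
rewrite [upd s vX _ x]updN // take_oversize ?(ltnW lx) //.
have {1}-> : upd s vX (s y) = upd (upd s vX (s y)) vE (nseq 0 S1).
  by rewrite [RHS]upd_idE // updN.
have [e le_e []] := if_eq_loop (s y) 0 s nbx.
move=> -> eE; set v := drop _ (s y) in eE *.
set s1 := upd (upd s vX v) vE (nseq e S1).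
have s1X : s1 vX = v by rewrite /s1; upds.
have s1E : s1 vE = nseq e S1 by rewrite /s1; upds.
rewrite [exec N (CCase vX _) _]exec_case s1X.
have [e' le_e' E'] : exists2 e', e' <= e.+1 &
   exec N (if is_blank (head SB v) then CSkip else CPush vE S1)
     (upd s1 vX (behead v)) = upd (upd s vX (behead v)) vE (nseq e' S1) /\
   (e' == 0) = (s x == s y).
  have vE' : (v == [::]) && (take (size (s x)) (s y) == s x) = (s x == s y).
    rewrite /v; apply/andP/eqP => [[/eqP d0 /eqP t]|->].
      by rewrite -[RHS](cat_take_drop (size (s x))) d0 t cats0.
    by rewrite drop_size take_size eqxx.
  have nbv : SB \notin v by apply: contra nby => /mem_drop.
  clear s1X; case: v nbv vE' @s1 s1E eE => [|b v] nbv vE' s1 s1E eE.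
    exists e => //; split; last by rewrite eE.
    by rewrite /s1 /=; store_eq.
  exists e.+1 => //; split; last by rewrite -vE'.
  have -> : is_blank (head SB (b :: v)) = false.
    by move: nbv; rewrite in_cons negb_or is_blankE eq_sym => /andP[/negbTE].
  by rewrite /= updN // s1E /s1; store_eq.
case: E' => -> e'E; rewrite exec_clear; last first.
  rewrite updN // updE size_behead /v size_drop; apply: leq_trans ly.
  exact: leq_trans (leq_pred _) (leq_subr _ _).
set s2 := upd _ vX [::].
have s2E : s2 vE = nseq e' S1 by rewrite /s2; upds.
rewrite exec_case s2E; clear s2E; case: e' le_e' e'E @s2 => [|e'] le_e' e'E s2.
  rewrite -e'E [is_blank _]/=; congr exec; rewrite /s2; store_eq.
rewrite -e'E [head _ _]/= [is_blank _]/= exec_clear.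
  by rewrite /s2; store_eq.
by rewrite updE size_nseq; lia.
Qed.

Lemma exec_if_longer x y c s : x != vX -> x != vE ->
  s vX = [::] -> s vE = [::] -> size (s x) <= N -> size (s y) <= N ->
  SB \notin s y ->
  exec N (if_longer x y c) s = if size (s y) < size (s x) then exec N c s else s.
Proof.
move=> xX xE sX sE lx ly nby.
rewrite /if_longer !exec_seq exec_copy // sX cat0s exec_for.
rewrite [upd s vX _ x]updN // take_oversize //.
have loop u v e : SB \notin v -> foldl (fun s (a : sym) => exec N
    (if is_blank (head SB (s vX)) then CPush vE S1 else CSkip) (upd s vX (behead (s vX))))
    (upd (upd s vX v) vE (nseq e S1)) u =
    upd (upd s vX (drop (size u) v)) vE (nseq (e + (size u - size v)) S1).
  elim: u v e => [|a u IHu] v e nb /=; first by rewrite drop0 sub0n addn0.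
  have -> : upd (upd s vX v) vE (nseq e S1) vX = v by upds.
  case: v nb => [|b v] nb /=.
    have -> : upd (upd (upd (upd s vX [::]) vE (nseq e S1)) vX [::]) vE
      (S1 :: upd (upd (upd s vX [::]) vE (nseq e S1)) vX [::] vE) =
      upd (upd s vX [::]) vE (nseq e.+1 S1) by store_eq.
    by rewrite IHu // subn0 addSnnS /=; case: (size u).
  move: nb; rewrite in_cons negb_or is_blankE eq_sym => /andP[/negbTE-> nb] /=.
  by rewrite -(IHu v e nb); congr (foldl _ _ _); store_eq.
have {1}-> : upd s vX (s y) = upd (upd s vX (s y)) vE (nseq 0 S1).
  by rewrite [RHS]upd_idE // updN.
rewrite loop // add0n exec_clear; last first.
  by rewrite updN // updE size_drop; apply: leq_trans ly; apply: leq_subr.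
set s2 := upd _ vX [::].
have s2E : s2 vE = nseq (size (s x) - size (s y)) S1 by rewrite /s2; upds.
rewrite exec_case s2E; case: ltnP => [lt_yx|le_xy].
  have [e eE] : exists e, size (s x) - size (s y) = e.+1.
    by exists (size (s x) - size (s y)).-1; lia.
  rewrite eE [is_blank _]/= exec_seq exec_clear ?updE ?size_nseq; last by lia.
  by congr exec; rewrite /s2; store_eq.
have eE : size (s x) - size (s y) = 0 by lia.
by rewrite eE /= /s2; store_eq.
Qed.

Lemma exec_for_words x w c s ws : s x = enc_words ws -> all bit_word ws ->
  size (s x) <= N -> s w = [::] -> keeps w c ->
  exec N (for_words x w c) s =
  foldl (fun s u => upd (exec N c (upd s w u)) w [::]) s ws.
Proof.
move=> sx bws lx sw kw; rewrite /= take_oversize // sx.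
rewrite {}sx in lx; set F := fun s a => exec N _ s.
elim: ws s bws lx sw => //= u ws IHws s /andP[bu bws].
rewrite /enc_words /= !size_cat /= => lx sw.
rewrite -catA foldl_cat /=.
have -> : foldl F s u = upd s w u.
  suff -> : foldl F s u = upd s w (s w ++ u) by rewrite sw.
  elim: u bu s {lx sw} => [|a u IHu] /=.
    by move=> _ s; rewrite cats0 upd_id.
  move=> /andP[a_bit bu] s; rewrite IHu //.
  have -> : F s a = upd s w (rcons (s w) a) by case/orP: a_bit => /eqP->.
  by rewrite updE upd_upd cat_rcons.
have -> : F (upd s w u) SSep = upd (exec N c (upd s w u)) w [::].
  rewrite -[LHS]/(exec N (CSeq c (clear w)) (upd s w u)) exec_seq exec_clear //.
  by rewrite exec_keeps // updE; lia.
by rewrite IHws ?updE //; rewrite /enc_words; lia.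
Qed.

(** Doubling is exact while the power is at most [N]. Once it exceeds [N], any further set bit
    copies [N] marks at once, and if there is none the result is exact. The proof generalizes over
    the current power [q] and the marks [e] collected so far. *)
Lemma exec_to_unary x y p s w : s x = w -> size w <= N -> s y = [::] ->
  s p = [::] -> x != p -> y != p -> 
  exists u, exists2 v, exec N (to_unary x y p) s = upd (upd s y (nseq u S1)) p v &
   u <= bits_value w /\ (u = bits_value w \/ N <= u).
Proof.
move=> sx lw sy sp xp yp; rewrite /to_unary exec_seq exec_for.
rewrite [exec N (CPush _ _) _]/= updN // sx take_oversize // sp.
set F := fun s a => exec N _ s.
have H q e s' : exists u, exists2 v,
    foldl F (upd (upd s' y (nseq e S1)) p (nseq q S1)) w =
      upd (upd s' y (nseq u S1)) p v &
    e <= u /\ (u <= e + q * bits_value w /\ (u = e + q * bits_value w \/ N <= u)); last first.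
  have [u [v E [_ H']]] := H 1 0 s; exists u, v; last by move: H'; rewrite add0n mul1n.
  by rewrite -E; congr (foldl _ _ _); store_eq.
elim: w q e s' {sx lw} => [|a w IHw] q e s'.
  by exists e; exists (nseq q S1) => //=; rewrite muln0 addn0; split=> //; split=> //; left.
rewrite [foldl _ _ _]/=.
pose e1 := e + (a == S1) * minn N q; pose q1 := q + minn N q.
have tk n : take n (nseq q S1) = nseq (minn n q) S1.
  have [le_nq|lt_qn] := leqP n q; first by rewrite take_nseq.
  by rewrite take_oversize ?size_nseq // ltnW.
have -> : F (upd (upd s' y (nseq e S1)) p (nseq q S1)) a =
    upd (upd s' y (nseq e1 S1)) p (nseq q1 S1).
  rewrite /F exec_seq.
  have -> : exec N (if a == S1 then copy p y else CSkip)
      (upd (upd s' y (nseq e S1)) p (nseq q S1)) =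
      upd (upd s' y (nseq e1 S1)) p (nseq q S1).
    rewrite /e1; case: eqP => _; last by rewrite addn0.
    rewrite exec_copy_trunc ?updE ?mem_nseq ?andbF // tk updN // updE -nseqD mul1n.
    by rewrite upd_updC 1?eq_sym // upd_upd.
  by rewrite exec_copy_trunc ?updE ?mem_nseq ?andbF // tk upd_upd -nseqD.
have [u [v -> [le_u [u_le u_or]]]] := IHw q1 e1 s'.
exists u; exists v => //; rewrite /e1 /q1 in le_u u_le u_or *; rewrite [bits_value _]/=.
have le_m := geq_minr N q; have mE : minn N q = q \/ N < q /\ minn N q = N.
  by rewrite /minn; case: ltnP; auto.
move: (bits_value w) (minn N q) (nat_of_bool (a == S1)) le_m mE u_le u_or le_u.
move=> b m i le_m mE u_le u_or le_u; have := leq_mul le_m (leqnn b).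
have := leq_mul (leqnn i) le_m => le_im le_mb.
split; first by lia.
rewrite mulnDr -muln2 mulnCA; split; first by nia.
case: u_or => [uE|]; last by right.
case: mE => [mE|[lt_Nq mE]]; first by left; rewrite uE mE; lia.
case: i {le_im} u_le uE le_u => [|i] u_le uE le_u; last by right; rewrite uE mE; nia.
case: b {le_mb} u_le uE => [|b] u_le uE; first by left; rewrite uE; lia.
by right; rewrite uE; nia.
Qed.

End Macros.

(** * Evaluation of a tuple of alternatives *)

(** [vIN] is input and output, [vD] the rankings, [vMU] and [vKU] the numbers of alternatives and of
    winners still to be chosen, in unary. During an evaluation, [vW] is the current word, [vC]
    counts the words left in the current ranking, [vG] tells that the agent is already served, [vSC]
    and [vAS] collect score and assignment, and [vBS] and [vBA] keep the best ones. The slots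
    [tvar j] hold the chosen words. *)
Notation vIN := 0 (only parsing).
Notation vD := 1 (only parsing).
Notation vMU := 2 (only parsing).
Notation vKU := 3 (only parsing).
Notation vW := 4 (only parsing).
Notation vC := 5 (only parsing).
Notation vG := 6 (only parsing).
Notation vSC := 7 (only parsing).
Notation vAS := 8 (only parsing).
Notation vBS := 9 (only parsing).
Notation vBA := 10 (only parsing).
Notation tvar j := (15 + j) (only parsing).

(** The flag [vG] is tested before each slot, so a word present in several slots is recorded
    once. *)
Definition find_in_slots js := foldr (fun j c =>
  CSeq (CCase vG (fun r => if is_blank r then
      if_eq vW (tvar j) (CSeq (copy vW vAS) (CSeq (CSnoc vAS SSep) (CPush vG S1)))
    else CPush vG r)) c) CSkip js.

(** A word read after the agent was served adds one mark to the score. When [vC] runs out, it is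
    refilled and the flag is reset for the next agent. *)
Definition read_word K0 :=
  CSeq (CCase vG (fun r => if is_blank r then CSkip
                           else CSeq (CPush vG r) (CSnoc vSC S1)))
  (CSeq (find_in_slots (iota 0 K0))
  (CSeq (CCase vC (fun _ => CSkip))
        (CCase vC (fun r => if is_blank r then CSeq (copy vMU vC) (clear vG)
                            else CPush vC r)))).

(** The score starts at 1, so that even a tuple of score 0 beats the initial empty record. *)
Definition evaluate K0 :=
  CSeq (CSnoc vSC S1) (CSeq (copy vMU vC) (CSeq (for_words vD vW (read_word K0))
  (CSeq (if_longer vSC vBS (CSeq (clear vBS) (CSeq (copy vSC vBS)
           (CSeq (clear vBA) (copy vAS vBA)))))
  (CSeq (clear vSC) (CSeq (clear vAS) (clear vC)))))).

Definition work s c (g : bool) sc (a : seq sym) : store :=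
  upd (upd (upd (upd s vC (nseq c S1)) vG (nseq g S1)) vSC (nseq sc S1)) vAS a.

Definition read_step (p : pred (seq sym)) m (q : nat * bool * nat * seq sym) w :=
  let: (c, g, sc, a) := q in
  let hit := ~~ g && p w in
  let a' := if hit then a ++ w ++ [:: SSep] else a in
  if c.-1 == 0 then (m, false, sc + g, a') else (c.-1, g || hit, sc + g, a').

(** A first hit at index [find p r] is followed by [c - (find p r).+1] words, each worth one mark;
    if the flag is already set, all [c] words count. *)
Lemma read_ranking p m r c g sc a : size r = c -> 0 < c ->
  foldl (read_step p m) (c, g, sc, a) r =
  (m, false, sc + (if g then c else c - (find p r).+1),
   a ++ (if ~~ g && has p r then nth [::] r (find p r) ++ [:: SSep] else [::])).
Proof.
move=> <- {c}; elim: r g sc a => // w r IHr g sc a _.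
rewrite [foldl _ _ _]/=; case: r IHr => [|w' r] IHr.
  rewrite /=; case: g; case: (p w); rewrite /= ?cats0 ?addn0 ?addn1 ?subnn ?addn0 //.
rewrite [_ == 0]/= IHr // -addnA; case: g => /=; first by congr (_, _, _, _); lia.
case: (p w) => /=; last by rewrite add0n.
by rewrite cats0 add0n; congr (_, _, _, _); lia.
Qed.

Definition score m (p : pred (seq sym)) rks := sumn [seq m - (find p r).+1 | r <- rks].

Definition assignment p rks := enc_words [seq nth [::] r (find p r) | r <- rks].

Lemma read_rankings p m rks sc a : 0 < m ->
  all (fun r => (size r == m) && has p r) rks ->
  foldl (read_step p m) (m, false, sc, a) (flatten rks) =
  (m, false, sc + score m p rks, a ++ assignment p rks).
Proof.
move=> m0; elim: rks sc a => [|r rks IHr] sc a /=; first by rewrite addn0 cats0.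
case/andP=> /andP[/eqP sr hr] ok.
rewrite foldl_cat (@read_ranking p m r m) // hr IHr //.
by rewrite /score /assignment /enc_words /= -addnA -catA.
Qed.

Lemma keeps_find_in_slots v js : 6 != v -> 8 != v -> 11 != v -> 12 != v ->
  keeps v (find_in_slots js).
Proof. by move=> v6 v8 v11 v12; elim: js => //= j js ->; rewrite v6 v8 v11 v12. Qed.

Lemma size_enc_words ws : size ws <= size (enc_words ws).
Proof.
elim: ws => //= w ws IH; rewrite /enc_words /= !size_cat /=.
by move: IH; rewrite /enc_words; lia.
Qed.

Lemma size_mem_enc_words w ws : w \in ws -> size w < size (enc_words ws).
Proof.
elim: ws => //= u ws IH; rewrite in_cons /enc_words /= !size_cat /=.
by case/predU1P=> [->|/IH]; rewrite /enc_words; lia.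
Qed.

(** Each ranking contributes a word of its own, or a mere separator when it has no hit. This keeps
    the recorded assignment within the loop bound. *)
Lemma size_assignment p rs : size (assignment p rs) <=
  size (enc_words (flatten rs)) + count (predC (has p)) rs.
Proof.
rewrite /assignment; elim: rs => //= r rs IH; rewrite /enc_words /= map_cat flatten_cat.
rewrite !size_cat /= -/(enc_words _) -/(enc_words r) -/(enc_words (flatten rs)).
move: IH; case: (boolP (has p r)) => [|hN]; last first.
  rewrite nth_default; first by rewrite /=; lia.
  by rewrite hasNfind.
by rewrite has_find => /(mem_nth [::])/size_mem_enc_words /=; lia.
Qed.

Lemma score_leq m p rs : all (fun r => size r == m) rs -> score m p rs <= size (flatten rs).
Proof.
rewrite /score; elim: rs => //= r rs IH /andP[/eqP sr /IH].
by rewrite size_cat; lia.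
Qed.

Section Evaluate.

Variables (N K0 m : nat) (rks : seq (seq (seq sym))).

Hypotheses (m0 : 0 < m) (mN : m <= N)
  (bits : all bit_word (flatten rks))
  (small : size (enc_words (flatten rks)) < N)
  (size_rks : all (fun r => size r == m) rks)
  (perm_rks : forall r w, r \in rks -> w \in flatten rks -> w \in r).

Definition scratch := [:: vW; vC; vG; vSC; vAS; vX; vE].

Definition env s := [/\ s vD = enc_words (flatten rks), s vMU = nseq m S1,
  forall v, v \in scratch -> s v = [::]
  & forall j, size (s (tvar j)) <= N /\ SB \notin s (tvar j)].

Definition slot_pred s : pred (seq sym) :=
  fun w => has (fun j => w == s (tvar j)) (iota 0 K0).

Lemma exec_find_in_slots js s (g : bool) : s vG = nseq g S1 ->
  s vX = [::] -> s vE = [::] -> size (s vW) < N -> SB \notin s vW ->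
  (forall j, size (s (tvar j)) <= N /\ SB \notin s (tvar j)) ->
  exec N (find_in_slots js) s =
  if ~~ g && has (fun j => s vW == s (tvar j)) js
  then upd (upd s vAS (s vAS ++ s vW ++ [:: SSep])) vG [:: S1] else s.
Proof.
elim: js s g => [|j js IH] s g sG sX sE lW nbW H; first by rewrite andbF.
rewrite [find_in_slots _]/= -/(find_in_slots js) exec_seq exec_case sG.
case: g sG => sG.
  rewrite [is_blank _]/= [exec N (CPush _ _) _]/= updE upd_upd upd_idE //.
  by rewrite (IH s true).
rewrite [behead _]/= upd_idE // [is_blank _]/=.
have [Hj nbj] := H j.
rewrite exec_if_eq //.
rewrite [has _ _]/=; case: eqP => [eqW|_]; last by rewrite (IH s false).
rewrite !exec_seq exec_copy // ?(ltnW lW) // [exec N (CSnoc _ _) _]/= [exec N (CPush _ _) _]/=.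
set s' := upd _ vG _.
have -> : s' = upd (upd s vAS (s vAS ++ s vW ++ [:: SSep])) vG [:: S1].
  rewrite /s'; store_eq; first by rewrite sG.
  by rewrite -cats1 -catA.
by rewrite (IH _ true) // ?updN // => i; rewrite !updN //; lia.
Qed.

Lemma exec_read_word s c g sc a w : env s -> 0 < c -> bit_word w ->
  size w < N ->
  upd (exec N (read_word K0) (upd (work s c g sc a) vW w)) vW [::] =
  let: (c', g', sc', a') := read_step (slot_pred s) m (c, g, sc, a) w in
  work s c' g' sc' a'.
Proof.
move=> [sD sM s0 st] c0 bw lw; rewrite /read_word !exec_seq.
set s1 := exec N (CCase vG _) _.
have -> : s1 = upd (work s c g (sc + g) a) vW w.
  rewrite /s1 exec_case /work; case: (g) => /=; last by rewrite addn0; store_eq.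
  by rewrite (nseqD sc 1) cats1; store_eq.
have s0W : s vW = [::] by apply: s0.
have s0X : s vX = [::] by apply: s0.
have s0E : s vE = [::] by apply: s0.
have nbw := bit_word_nonblank bw.
have stw j : upd (work s c g (sc + g) a) vW w (tvar j) = s (tvar j).
  by rewrite /work !updN //; lia.
rewrite (@exec_find_in_slots _ _ g) //.
rewrite (eq_has (a2 := fun j => w == s (tvar j))); last first.
  by move=> j; rewrite updE stw.
rewrite -/(slot_pred s w) /read_step; set hit := ~~ g && _.
set s2 := if hit then _ else _; set a' := if hit then _ else _.
have -> : s2 = upd (work s c (g || hit) (sc + g) a') vW w.
  rewrite /s2 /a' /hit /work; case: ifP => [/andP[gN _]|_]; last by rewrite orbF.
  rewrite orbT; store_eq.
rewrite [exec N (CCase vC (fun=> CSkip)) _]exec_case [exec N CSkip _]/=.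
set s3 := upd _ vC _.
have -> : s3 = upd (work s c.-1 (g || hit) (sc + g) a') vW w.
  by rewrite /s3 /work; case: (c) => [|n]; store_eq.
rewrite exec_case.
have -> : upd (work s c.-1 (g || hit) (sc + g) a') vW w vC = nseq c.-1 S1 by [].
case: c.-1 => [|n].
  rewrite [is_blank _]/= exec_seq exec_copy.
  - rewrite exec_clear.
      by rewrite /work; store_eq; rewrite ?sM ?s0W.
    by rewrite /work /upd /= size_nseq; case: (g || hit); lia.
  - by rewrite /work /upd /= sM size_nseq.
  - by rewrite /work /upd /= sM mem_nseq andbF.
by rewrite [is_blank _]/= /=; rewrite /work; store_eq.
Qed.

Lemma exec_read_words s c g sc a ws : env s -> 0 < c -> all bit_word ws ->
  all (fun w => size w < N) ws ->
  foldl (fun s w => upd (exec N (read_word K0) (upd s vW w)) vW [::])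
    (work s c g sc a) ws =
  let: (c', g', sc', a') := foldl (read_step (slot_pred s) m) (c, g, sc, a) ws in
  work s c' g' sc' a'.
Proof.
move=> es; elim: ws c g sc a => //= w ws IH c g sc a c0 /andP[bw bws] /andP[lw lws].
rewrite (exec_read_word _ _ _ es) //= /read_step; case: eqP => cN; first by rewrite IH.
by rewrite IH //; lia.
Qed.

Definition put s (b : nat * seq sym) : store := upd (upd s vBS (nseq b.1 S1)) vBA b.2.

Definition better (p : pred (seq sym)) (b : nat * seq sym) :=
  if b.1 < (score m p rks).+1 then ((score m p rks).+1, assignment p rks) else b.

Lemma env_upd s i v : env s -> i < 15 -> i \notin vD :: vMU :: scratch ->
  env (upd s i v).
Proof.
move=> [sD sM s0 st] lt_i; rewrite in_cons negb_or in_cons negb_or => /and3P[iD iM iS].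
have iN j : j \in scratch -> j != i by apply: contraTneq => ->.
split=> [||j jS|j].
- by rewrite updN // eq_sym.
- by rewrite updN // eq_sym.
- by rewrite updN ?s0 ?iN.
- by rewrite updN //; lia.
Qed.

Lemma slot_pred_upd s i v : i < 15 -> slot_pred (upd s i v) = slot_pred s.
Proof.
move=> lt_i; apply: functional_extensionality => w; apply: eq_has => j.
by rewrite updN //; lia.
Qed.

Lemma bounded_better p b : b.1 <= N -> size b.2 <= N -> all (has p) rks ->
  (better p b).1 <= N /\ size (better p b).2 <= N.
Proof.
move=> b1 b2 hp; rewrite /better; case: ifP => //= _; split.
  have := score_leq p size_rks; have := size_enc_words (flatten rks); lia.
have := size_assignment p rks; rewrite (eq_in_count (a2 := pred0)) ?count_pred0; first by lia.
by move=> r /(allP hp) /= ->.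
Qed.

Lemma exec_evaluate s b : env s -> all (has (slot_pred s)) rks ->
  b.1 <= N -> size b.2 <= N ->
  exec N (evaluate K0) (put s b) = put s (better (slot_pred s) b).
Proof.
move=> es hp b1 b2.
(* The record [(0, [::])] is always improved, so the bounds on the improved record are bounds on
   this score and this assignment. *)
have [sc_le as_le] : (score m (slot_pred s) rks).+1 <= N /\
    size (assignment (slot_pred s) rks) <= N.
  by have [] := @bounded_better (slot_pred s) (0, [::]) isT isT hp; rewrite /better.
have es1 : env (put s b) by do 2 apply: env_upd => //.
have tE : slot_pred (put s b) = slot_pred s by rewrite /put !slot_pred_upd.
case: (es) => sD sM s0 st.
have sC : s vC = [::] by apply: s0.
have sG : s vG = [::] by apply: s0.
have sSC : s vSC = [::] by apply: s0.
have sAS : s vAS = [::] by apply: s0.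
rewrite /evaluate 6!exec_seq [exec N (CSnoc _ _) _]/= exec_copy; first last.
- by rewrite /put /upd /= sM mem_nseq andbF.
- by rewrite /put /upd /= sM size_nseq.
set s1 := upd _ vC _; have -> : s1 = work (put s b) m false 1 [::].
  by rewrite /s1 /work /put; store_eq; rewrite ?sC ?sG ?sSC ?sAS ?sM.
have s0W : s vW = [::] by apply: s0.
rewrite (@exec_for_words _ _ _ _ _ (flatten rks)) //; first last.
- by rewrite /= keeps_find_in_slots.
- by rewrite /work /put /upd /= sD ltnW.
rewrite exec_read_words //; last first.
  by apply/allP => w /size_mem_enc_words lt_w; apply: ltn_trans lt_w small.
rewrite tE read_rankings //; last first.
  by rewrite all_predI size_rks.
set sc := score _ _ _ in sc_le *; set asg := assignment _ _ in as_le *.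
rewrite add1n cat0s.
have s0X : s vX = [::] by apply: s0.
have s0E : s vE = [::] by apply: s0.
rewrite exec_if_longer //; first last.
- by rewrite /work /put /upd /= mem_nseq andbF.
- by rewrite /work /put /upd /= size_nseq.
- by rewrite /work /put /upd /= size_nseq.
have -> : work (put s b) m false sc.+1 asg vBS = nseq b.1 S1 by [].
have -> : work (put s b) m false sc.+1 asg vSC = nseq sc.+1 S1 by [].
rewrite !size_nseq.
have nbA : SB \notin asg.
  apply: enc_words_nonblank; apply/allP => w /mapP[r r_in ->].
  apply: (allP bits); apply/flattenP; exists r => //.
  by apply: mem_nth; rewrite -has_find (allP hp).
have nbn n : SB \notin nseq n S1 by rewrite mem_nseq andbF.
set s2 := if _ then _ else _.
have -> : s2 = work (put s (better (slot_pred s) b)) m false sc.+1 asg.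
  rewrite /s2 /better -/sc -/asg; case: ltnP => // _.
  rewrite 3!exec_seq (exec_clear (x := vBS)); last by rewrite /work /put /upd /= size_nseq.
  rewrite (exec_copy (x := vSC)); first last.
  - exact: (nbn sc.+1).
  - by rewrite /work /put /upd /= size_nseq.
  rewrite (exec_clear (x := vBA)); last by rewrite /work /put /upd /=.
  rewrite exec_copy //.
  by rewrite /work /put; store_eq.
rewrite (exec_clear (x := vSC)); last by rewrite /work /put /upd /= size_nseq.
rewrite (exec_clear (x := vAS)); last by rewrite /work /put /upd /=.
rewrite exec_clear; last by rewrite /work /put /upd /= size_nseq.
by rewrite /work /put; store_eq; rewrite ?sC ?sG ?sSC ?sAS.
Qed.

End Evaluate.

(** * Enumeration of the tuples *)

(** The loops are nested at most [K0] deep, a constant. Slots are filled from the last to the first;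
    a mark taken from [vKU] is put back afterwards, so that all choices for a slot see the same
    number of winners left. *)
Fixpoint enumerate K0 j :=
  match j with
  | 0 => evaluate K0
  | i.+1 => CCase vKU (fun r =>
      if is_blank r then
        (* an unused slot holds a word that is not the code of an alternative *)
        CSeq (CPush (tvar i) SSep) (CSeq (enumerate K0 i) (CCase (tvar i) (fun _ => CSkip)))
      else CSeq (for_words vD (tvar i) (enumerate K0 i)) (CPush vKU r))
  end.

Fixpoint tuples (T : Type) (ws : seq T) j k (t : seq T) : seq (seq T) :=
  match j, k with
  | 0, _ => [:: t]
  | i.+1, 0 => tuples ws i 0 t
  | i.+1, l.+1 => flatten [seq tuples ws i l (w :: t) | w <- ws]
  end.

Lemma keeps_enumerate K0 i j : j <= i -> keeps (tvar i) (enumerate K0 j).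
Proof.
elim: j => [|j IH] le_ji.
  rewrite /=; rewrite keeps_find_in_slots //; by rewrite ?andbT; lia.
have kj : keeps (tvar i) (enumerate K0 j) by apply: IH; lia.
have ji : (tvar j != tvar i) by lia.
by rewrite /= kj ji.
Qed.

Section Enumerate.

Variables (N K0 m : nat) (rks : seq (seq (seq sym))).

Hypotheses (m0 : 0 < m) (mN : m <= N)
  (bits : all bit_word (flatten rks))
  (small : size (enc_words (flatten rks)) < N)
  (size_rks : all (fun r => size r == m) rks)
  (perm_rks : forall r w, r \in rks -> w \in flatten rks -> w \in r).

Let ws := flatten rks.

Notation better := (better m rks).
Notation env := (env N m rks).

Definition best b (L : seq (seq (seq sym))) :=
  foldl (fun b T => better (fun w => w \in T) b) b L.

Lemma better_eq p q b : {in ws, p =1 q} -> better p b = better q b.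
Proof.
move=> pq; have fE : {in rks, forall r, find p r = find q r}.
  by move=> r r_in; apply: eq_in_find => w w_in; apply: pq; apply/flattenP; exists r.
have sE : score m p rks = score m q rks.
  by rewrite /score; congr sumn; apply/eq_in_map => r /fE ->.
have aE : assignment p rks = assignment q rks.
  by congr enc_words; apply/eq_in_map => r /fE ->.
by rewrite /better sE aE.
Qed.

Lemma env_tvar s i v : env s -> size v <= N -> SB \notin v -> env (upd s (tvar i) v).
Proof.
move=> [sD sM s0 st] lv nbv; split=> [||j jS|j].
- by rewrite updN //; lia.
- by rewrite updN //; lia.
- rewrite updN ?s0 //; move: jS; rewrite !inE; lia.
- by rewrite /upd; case: eqP.
Qed.

Definition selects s j (T : seq (seq sym)) := forall w, bit_word w ->
  has (fun i => w == s (tvar i)) (iota j (K0 - j)) = (w \in T).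

(** The disjunction on [T] ensures that the completed tuple is not empty. One of its words then
    occurs in every ranking, so that every agent gets an alternative. *)
Lemma exec_enumerate j k T s b : j <= K0 -> env s -> s vKU = nseq k S1 ->
  (forall i, i < j -> s (tvar i) = [::]) -> selects s j T ->
  {subset T <= ws} -> (T != [::]) || (0 < j) && (0 < k) ->
  b.1 <= N -> size b.2 <= N ->
  let b' := best b (tuples ws j k T) in
  [/\ exec N (enumerate K0 j) (put s b) = put s b', b'.1 <= N & size b'.2 <= N].
Proof.
elim: j k T s b => [|j IH] k T s b le_j es sK st selT subT TN b1 b2.
  rewrite andFb orbF in TN.
  have tE : {in ws, slot_pred K0 s =1 (fun w => w \in T)}.
    by move=> w /(allP bits) bw; rewrite -selT // subn0.
  have hp : all (has (slot_pred K0 s)) rks.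
    apply/allP => r r_in; case: T TN subT selT tE => // t T _ subT selT tE.
    have t_ws : t \in ws by apply: subT; rewrite mem_head.
    apply/hasP; exists t; first exact: perm_rks.
    by rewrite tE ?mem_head.
  rewrite /best [tuples _ _ _ _]/= [foldl _ _ _]/= -(better_eq _ tE).
  rewrite -[enumerate K0 0]/(evaluate K0) (@exec_evaluate N K0 m rks) //.
  by have [] := bounded_better m0 mN bits small size_rks b1 b2 hp.
have st' : s (tvar j) = [::] by apply: st.
have iotaE : iota j (K0 - j) = j :: iota j.+1 (K0 - j.+1).
  by have -> : K0 - j = (K0 - j.+1).+1 by lia.
have putK : put s b vKU = nseq k S1 by rewrite -sK.
rewrite [enumerate _ _]/= exec_case putK.
case: k sK putK TN => [|k] sK putK TN.
  rewrite andbF orbF in TN.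
  rewrite [is_blank _]/= 2!exec_seq [exec N (CPush _ _) _]/=.
  pose s1 := upd s (tvar j) [:: SSep].
  have -> : upd (upd (put s b) 3 [::]) (tvar j)
      (SSep :: upd (put s b) 3 [::] (tvar j)) = put s1 b.
    by rewrite /s1 /put; store_eq; rewrite ?sK ?st'.
  have es1 : env s1 by apply: env_tvar => //=; lia.
  have s1K : s1 vKU = nseq 0 S1 by rewrite /s1 updN.
  have s1t i : i < j -> s1 (tvar i) = [::].
    by move=> lt_ij; rewrite /s1 updN ?st //; lia.
  have sel1 : selects s1 j T.
    move=> w bw; rewrite iotaE /= /s1 updE.
    have /negbTE-> : w != [:: SSep] by apply: contraTneq bw => ->.
    rewrite -selT //; apply: eq_in_has => i; rewrite mem_iota => /andP[lt_ji _].
    by rewrite updN //; lia.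
  have [-> b'1 b'2] := IH 0 T s1 b (ltnW le_j) es1 s1K s1t sel1 subT (ltac:(by rewrite TN)) b1 b2.
  split=> //; rewrite exec_case [exec N CSkip _]/=.
  by rewrite /s1 /put; store_eq; rewrite ?st'.
rewrite [is_blank _]/= exec_seq [behead _]/=.
pose s1 := upd s vKU (nseq k S1).
have -> : upd (put s b) vKU (nseq k S1) = put s1 b by rewrite /s1 /put; store_eq.
have es1 : env s1 by apply: env_upd.
have es1D : s1 vD = enc_words ws by case: es1.
rewrite (@exec_for_words _ _ _ _ _ ws) //; first last.
- exact: keeps_enumerate.
- by rewrite /put !updN // es1D ltnW.
(* Inner induction over the words tried in slot [j], threading the best record. *)
have loop vs b0 : {subset vs <= ws} -> b0.1 <= N -> size b0.2 <= N ->
   let b' := best b0 (flatten [seq tuples ws j k (w :: T) | w <- vs]) in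
   [/\ foldl (fun s u => upd (exec N (enumerate K0 j) (upd s (tvar j) u)) (tvar j) [::])
     (put s1 b0) vs = put s1 b', b'.1 <= N & size b'.2 <= N].
  elim: vs b0 => [|w vs IHvs] b0 subv b01 b02; first by split.
  rewrite [flatten _]/= /best foldl_cat -!/(best _ _).
  have w_in : w \in ws by apply: subv; rewrite mem_head.
  have bw := allP bits _ w_in.
  pose s2 := upd s1 (tvar j) w.
  have p2 : upd (put s1 b0) (tvar j) w = put s2 b0 by rewrite /s2 /put; store_eq.
  have es2 : env s2.
    apply: env_tvar => //; last exact: bit_word_nonblank.
    by have := size_mem_enc_words w_in; move: small; rewrite -/ws; lia.
  have s2K : s2 vKU = nseq k S1 by rewrite /s2 updN ?updE //; lia.
  have s2t i : i < j -> s2 (tvar i) = [::].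
    by move=> lt_ij; rewrite /s2 /s1 !updN ?st //; lia.
  have sel2 : selects s2 j (w :: T).
    move=> v bv; rewrite iotaE /= /s2 updE in_cons; congr (_ || _).
    rewrite -selT //; apply: eq_in_has => i; rewrite mem_iota => /andP[lt_ji _].
    by rewrite /s1 !updN //; lia.
  have sub2 : {subset w :: T <= ws}.
    by move=> v; rewrite in_cons => /predU1P[->|/subT].
  have [E b'1 b'2] := IH k (w :: T) s2 b0 (ltnW le_j) es2 s2K s2t sel2 sub2 isT b01 b02.
  rewrite [foldl _ _ _]/= p2 E.
  have -> : upd (put s2 (best b0 (tuples ws j k (w :: T)))) (tvar j) [::] =
      put s1 (best b0 (tuples ws j k (w :: T))).
    rewrite /s2 /put; store_eq; rewrite /s1 updN ?st' //; lia.
  by apply: IHvs => // v v_in; apply: subv; rewrite in_cons v_in orbT.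
have [-> b'1 b'2] := loop ws b (fun _ => id) b1 b2.
split=> //; rewrite [exec N (CPush _ _) _]/= /s1 /put.
by store_eq; rewrite sK.
Qed.

End Enumerate.

(** Records store the score plus one, so an initial 0 cannot survive a non-empty list. *)
Lemma best_max m rks b L : L != [::] -> b.1 = 0 ->
  exists2 T, T \in L & (best m rks b L).2 = assignment (fun w => w \in T) rks /\
  forall T', T' \in L ->
    score m (fun w => w \in T') rks <= score m (fun w => w \in T) rks.
Proof.
pose sc (T : seq (seq sym)) := score m (fun w => w \in T) rks.
have H (L' : seq (seq (seq sym))) b0 : 
    (b0.1 <= (best m rks b0 L').1) /\ (forall T', T' \in L' -> sc T' < (best m rks b0 L').1) /\
    (best m rks b0 L' = b0 \/ exists2 T, T \in L' & (best m rks b0 L').1 = (sc T).+1 /\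
      (best m rks b0 L').2 = assignment (fun w => w \in T) rks).
  elim: L' b0 => [|T L' IHL] b0 /=; first by split=> //; split=> //; left.
  rewrite /best /= -/(best _ _ _ _); set b1 := better _ _ _ b0.
  have b1E : (b1 = b0 /\ sc T < b0.1) \/
      (b1 = ((sc T).+1, assignment (fun w => w \in T) rks) /\ b0.1 <= sc T).
    by rewrite /b1 /better ltnS; case: leqP => ?; [right | left].
  have [le1 [lt1 or1]] := IHL b1; split; [|split].
  - by case: b1E le1 => [[-> _]|[-> /=]] //; lia.
  - move=> T'; rewrite in_cons => /predU1P[->|/lt1 //].
    by case: b1E le1 => [[-> lt_b]|[-> _]] //=; lia.
  case: or1 => [->|[T' T'_in E]].
    case: b1E => [[-> _]|[-> _]]; first by left.
    by right; exists T; rewrite ?mem_head.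
  by right; exists T' => //; rewrite in_cons T'_in orbT.
move=> LN b0; have [_ [lt_sc or_b]] := H L b.
have [T0 T0_in] : exists T0, T0 \in L by case: (L) LN => // T0 *; exists T0; rewrite mem_head.
case: or_b => [E|[T T_in [E1 E2]]].
  by have := lt_sc _ T0_in; rewrite E b0.
by exists T => //; split=> // T' /lt_sc; rewrite E1 ltnS.
Qed.

(** * Which tuples are enumerated *)

Lemma tuplesP (T : eqType) (ws : seq T) j k (t u : seq T) :
  u \in tuples ws j k t ->
  size u = size t + minn j k /\ {subset u <= t ++ ws}.
Proof.
elim: j k t => [|j IH] k t /=.
  rewrite inE => /eqP->; rewrite min0n addn0; split=> // x.
  by rewrite mem_cat => ->.
case: k => [/IH|k /flattenP[s /mapP[w w_in ->] /IH[-> sub]]].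
  by rewrite !minn0.
split=> [|x /sub]; first by rewrite minnSS addSnnS.
by rewrite /= in_cons => /predU1P[->|//]; rewrite mem_cat w_in orbT.
Qed.

(** Words are put in front of [t] as they are chosen, hence the reversal. *)
Lemma mem_tuples (T : eqType) (ws : seq T) j k (t u : seq T) :
  {subset u <= ws} -> size u = minn j k -> catrev u t \in tuples ws j k t.
Proof.
elim: j k t u => [|j IH] k t u sub /=.
  by rewrite min0n => /size0nil ->; rewrite inE.
case: k => [|k]; first by move=> su; apply: IH; rewrite ?minn0 // su minn0.
rewrite minnSS; case: u sub => [|w u] sub //= [su].
apply/flattenP; exists (tuples ws j k (w :: t)).
  by apply: map_f; apply: sub; rewrite mem_head.
by apply: IH => // x x_in; apply: sub; rewrite in_cons x_in orbT.
Qed.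

(** * The program *)

(* The three symbols put on [vE] tell the first three words of the input apart:
   the number of agents is skipped, the numbers of alternatives and of winners
   are turned into unary. *)
Definition parse_word :=
  CCase vE (fun r => match r with
    | S0 => CSkip
    | S1 => to_unary vW vMU 13
    | SSep => to_unary vW vKU 14
    | SB => CSeq (copy vW vD) (CSnoc vD SSep)
    end).

Definition parse :=
  CSeq (CSnoc vE S0) (CSeq (CSnoc vE S1) (CSeq (CSnoc vE SSep)
    (for_words vIN vW parse_word))).

Definition program K0 :=
  CSeq parse (CSeq (enumerate K0 K0) (CSeq (clear vIN) (copy vBA vIN))).

Lemma com_ok_find_in_slots (P : pred nat) js : P vW -> P vG -> P vAS -> P vX ->
  P vE -> all (fun j => P (tvar j)) js -> com_ok P (find_in_slots js).
Proof.
move=> P4 P6 P8 P11 P12; elim: js => //= j js IH /andP[Pj /IH ->].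
by rewrite Pj P4 P6 P8 P11 P12.
Qed.

Lemma com_ok_enumerate K0 j : j <= K0 ->
  com_ok (fun x => x < 15 + K0) (enumerate K0 j).
Proof.
elim: j => [|j IH] le_j.
  have okf : com_ok (fun x => x < 15 + K0) (find_in_slots (iota 0 K0)).
    by apply: com_ok_find_in_slots => //; apply/allP => i; rewrite mem_iota; lia.
  by rewrite /= okf.
by rewrite /= IH ?(ltnW le_j) // !ltn_add2l le_j.
Qed.

Lemma com_ok_program K0 : com_ok (fun x => x < 15 + K0) (program K0).
Proof. by rewrite /= com_ok_enumerate. Qed.

Lemma exec_parse N wn wm wk ws : let x := enc_words [:: wn, wm, wk & ws] in
  all bit_word [:: wn, wm, wk & ws] -> size x <= N ->
  exists um uk, let s := exec N parse (init_store x) in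
  [/\ s vIN = x /\ s vD = enc_words ws, s vMU = nseq um S1 /\ s vKU = nseq uk S1,
      forall v, v \notin [:: vIN; vD; vMU; vKU; 13; 14] -> s v = [::],
      um <= bits_value wm /\ (um = bits_value wm \/ N <= um)
    & uk <= bits_value wk /\ (uk = bits_value wk \/ N <= uk)].
Proof.
move=> x bws lx.
have [bn [bm [bk bw]]] : bit_word wn /\ bit_word wm /\ bit_word wk /\ all bit_word ws.
  by case/and4P: bws.
have lw w : w \in [:: wn, wm, wk & ws] -> size w < N.
  by move/size_mem_enc_words => lt_w; apply: leq_trans lt_w lx.
have lm : size wm <= N by apply/ltnW/lw; rewrite !inE eqxx orbT.
have lk : size wk <= N by apply/ltnW/lw; rewrite !inE eqxx !orbT.
(* [s3] and [s4] are the stores in which the second and the third word are about to be converted;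
   they provide the witnesses [um] and [uk]. *)
pose s3 := upd (upd (init_store x) vW wm) vE [:: SSep].
have [um [vm Em Hm]] := @exec_to_unary N vW vMU 13 s3 wm erefl lm erefl erefl isT isT.
pose s4 := upd (upd (upd (upd (init_store x) vW wk) vE [::]) vMU (nseq um S1)) 13 vm.
have [uk [vk Ek Hk]] := @exec_to_unary N vW vKU 14 s4 wk erefl lk erefl erefl isT isT.
have Fws vs s : all bit_word vs -> all (fun w => size w < N) vs ->
    s vE = [::] -> s vW = [::] ->
    foldl (fun s u => upd (exec N parse_word (upd s vW u)) vW [::]) s vs =
    upd s vD (s vD ++ enc_words vs).
  elim: vs s => [|v vs IH] s /=; first by rewrite cats0 upd_id.
  move=> /andP[bv bvs] /andP[lv lvs] sE sW.
  have -> : upd (exec N parse_word (upd s vW v)) vW [::] =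
      upd s vD (s vD ++ v ++ [:: SSep]).
    rewrite /parse_word exec_case updN // sE exec_seq exec_copy; first last.
    - by rewrite /upd /= bit_word_nonblank.
    - by rewrite /upd /= ltnW.
    rewrite /=; store_eq; rewrite ?sE ?sW //.
    by rewrite -cats1 -catA.
  by rewrite IH // upd_upd updE /enc_words /= -!catA.
have -> : exec N parse (init_store x) =
    upd (upd (upd (upd (upd s4 vKU (nseq uk S1)) 14 vk) vW [::]) vD (enc_words ws)) vE [::].
  rewrite /parse 3!exec_seq; set s1 := exec N (CSnoc vE SSep) _.
  have -> : s1 = upd (init_store x) vE [:: S0; S1; SSep].
    by rewrite /s1 /= /init_store; store_eq.
  rewrite (@exec_for_words _ _ _ _ _ [:: wn, wm, wk & ws]) //.
  set F := fun s u => upd _ vW [::].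
  have F3 s : foldl F s [:: wn, wm, wk & ws] = foldl F (F (F (F s wn) wm) wk) ws by [].
  have Fn : F (upd (init_store x) vE [:: S0; S1; SSep]) wn =
      upd (init_store x) vE [:: S1; SSep].
    by rewrite /F /parse_word exec_case /init_store /=; store_eq.
  have Fm : F (upd (init_store x) vE [:: S1; SSep]) wm =
      upd (upd (upd s3 vMU (nseq um S1)) 13 vm) vW [::].
    rewrite -Em /F /parse_word exec_case; congr upd.
    apply: (congr1 (exec N (to_unary vW vMU 13))).
    by rewrite /s3; store_eq.
  have Fk : F (upd (upd (upd s3 vMU (nseq um S1)) 13 vm) vW [::]) wk =
      upd (upd (upd s4 vKU (nseq uk S1)) 14 vk) vW [::].
    rewrite -Ek /F /parse_word exec_case; congr upd.
    apply: (congr1 (exec N (to_unary vW vKU 14))).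
    by rewrite /s4 /s3; store_eq.
  rewrite F3 Fn Fm Fk /F Fws //; last first.
    by apply/allP => w w_in; apply: lw; rewrite !in_cons w_in !orbT.
  by rewrite /s4 /s3 /init_store; store_eq.
exists um, uk; split=> // v; rewrite !inE !negb_or.
case/and5P=> v0 v1 v2 v3 /andP[v13 v14].
by rewrite /s4 /init_store; upds.
Qed.

Section Program.

Variables (N K0 m : nat) (wn wm wk : seq sym) (rks : seq (seq (seq sym))).

Let x := enc_words [:: wn, wm, wk & flatten rks].

Hypotheses (K0_gt0 : 0 < K0) (K0N : K0 <= N) (xN : size x <= N)
  (bits : all bit_word [:: wn, wm, wk & flatten rks])
  (K_gt0 : 0 < bits_value wk)
  (size_rks : all (fun r => size r == bits_value wm) rks)
  (perm_rks : forall r w, r \in rks -> w \in flatten rks -> w \in r).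

Let out := exec N (program K0) (init_store x) vIN.

Lemma nonblank_input : SB \notin x.
Proof. exact: enc_words_nonblank. Qed.

Lemma size_words : size (enc_words (flatten rks)) + 3 <= size x.
Proof. by clear -x; rewrite /x /enc_words /= !size_cat /=; lia. Qed.

(** Nothing bounds [m] by the input length here, so its unary form may be truncated; but the
    outermost search loop runs over no words and the best record stays empty. *)
Lemma exec_program_nil : rks = [::] -> out = [::].
Proof.
clear size_rks perm_rks; move=> rks0; have [um [uk]] := exec_parse bits xN.
rewrite -/x; set s := exec N parse _; move=> [[sI sD] [sM sK] s0 _ [uk_le uk_or]].
have uk0 : 0 < uk by case: uk_or; lia.
have E : exec N (enumerate K0 K0) s = s.
  case: (K0) K0_gt0 => // j _; rewrite [enumerate _ _]/= exec_case sK.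
  case: uk {uk_le uk_or} uk0 sK => // k _ sK.
  rewrite [is_blank _]/= exec_seq /for_words exec_for updN // sD rks0 /=.
  by rewrite /upd /=; store_eq; rewrite sK.
rewrite /out /program 3!exec_seq E exec_clear ?sI //.
have sB : upd s vIN [::] vBA = [::] by rewrite updN // s0.
by rewrite exec_copy sB // updE cats0 updE.
Qed.

Lemma exec_program : rks != [::] -> 0 < bits_value wm ->
  exists2 T : seq (seq sym), size T = minn K0 (bits_value wk) /\ {subset T <= flatten rks} &
  out = assignment (fun w => w \in T) rks /\
  forall T' : seq (seq sym), size T' = minn K0 (bits_value wk) -> {subset T' <= flatten rks} ->
   score (bits_value wm) (fun w => w \in T') rks <=
   score (bits_value wm) (fun w => w \in T) rks.
Proof.
set n := bits_value wm => rksN n0; have [um [uk]] := exec_parse bits xN.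
rewrite -/x -/n; set s := exec N parse _.
move=> [[sI sD] [sM sK] s0 [um_le um_or] [uk_le uk_or]].
have lt_x := size_words.
(* Some ranking lists all the alternatives in the input, so their number was converted exactly. *)
have n_lt : n < N.
  have : n <= size (flatten rks).
    case: (rks) rksN size_rks => //= r rs _ /andP[/eqP sr _].
    by rewrite size_cat -/n in sr *; rewrite sr leq_addr.
  have := size_enc_words (flatten rks); lia.
have {um_or um_le} um_n : um = n by case: um_or => //; lia.
rewrite {}um_n in sM.
have uk0 : 0 < uk by case: uk_or; lia.
(* A truncated value is at least [N], hence at least [K0]. *)
have kE : minn K0 uk = minn K0 (bits_value wk) by case: uk_or; lia.
have bits' : all bit_word (flatten rks) by case/and4P: bits.
have small : size (enc_words (flatten rks)) < N by lia.
have es : env N n rks s.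
  split=> // [v v_in|j]; last by rewrite s0 // !inE; lia.
  by apply: s0; move: v_in; rewrite !inE; lia.
have put0 : put s (0, [::]) = s.
  by rewrite /put /=; store_eq; rewrite s0.
have st i : i < K0 -> s (tvar i) = [::] by move=> _; rewrite s0 // !inE; lia.
have sel : selects K0 s K0 [::] by move=> w _; rewrite subnn.
have [] := @exec_enumerate N K0 n rks n0 (ltnW n_lt) bits' small size_rks perm_rks
  K0 uk [::] s (0, [::]) (leqnn _) es sK st sel.
- by [].
- by rewrite K0_gt0 uk0.
- by [].
- by [].
set L := tuples _ _ _ _; rewrite put0 => E _ b2.
have Lmem (T' : seq (seq sym)) : size T' = minn K0 (bits_value wk) ->
    {subset T' <= flatten rks} -> rev T' \in L.
  by move=> sT' subT'; apply: mem_tuples => //; rewrite kE.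
(* Tuples may repeat a word, so a constant one is in [L]. *)
have L0 : L != [::].
  have [w w_in] : exists w, w \in flatten rks.
    have : 0 < size (flatten rks).
      by case: (rks) rksN size_rks => //= r rs _ /andP[/eqP sr _]; rewrite size_cat sr ltn_addr.
    by case: (flatten rks) => // w ? _; exists w; rewrite mem_head.
  have := Lmem (nseq (minn K0 (bits_value wk)) w) (size_nseq _ _).
  case: L {E b2 Lmem} => // H; exfalso.
  suff : rev (nseq (minn K0 (bits_value wk)) w) \in [::] by [].
  by apply: H => v /nseqP[-> _].
have [T T_in [ET T_max]] := @best_max n rks (0, [::]) L L0 erefl.
have [sT subT] := tuplesP T_in.
exists T; first by split=> [|w /subT //]; rewrite sT kE.
split; last first.
  move=> T' sT' subT'; have := T_max _ (Lmem T' sT' subT').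
  by have -> : (fun w => w \in rev T') = (fun w => w \in T')
    by apply: functional_extensionality => w; rewrite mem_rev.
rewrite -ET; set b := best _ _ _ _ in E b2 *.
have nbs : nonblank (put s b).
  rewrite -E; do 2 apply: exec_nonblank.
  by move=> i; rewrite /init_store /upd; case: eqP => // _; exact: nonblank_input.
have nbA := nbs vBA.
rewrite /out /program 3!exec_seq -/s E exec_clear.
  by rewrite exec_copy // updE.
by rewrite /put /upd /= sI.
Qed.

End Program.

(** * Positions in the rankings *)

Lemma bits_auxP fuel n : n <= fuel ->
  bits_value (bits_aux fuel n) = n /\ bit_word (bits_aux fuel n).
Proof.
elim: fuel n => [|fuel IH] [|n] //= le_n.
have [|E bw] := IH (uphalf n); first by rewrite uphalf_half; lia.
rewrite E bw andbT; split; last by case: ifP.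
by have := odd_double_half n.+1; rewrite /=; case: (odd n).
Qed.

Lemma bits_value_bin n : bits_value (bin n) = n.
Proof. by have [] := bits_auxP (leqnn n). Qed.

Lemma bit_word_bin n : bit_word (bin n).
Proof. by have [] := bits_auxP (leqnn n). Qed.

Lemma bin_inj : injective bin.
Proof. exact: can_inj bits_value_bin. Qed.

Lemma enc_natsE s : enc_nats s = enc_words [seq bin a | a <- s].
Proof. by rewrite /enc_words -map_comp. Qed.

Lemma sum_lt m c : c <= m -> \sum_(x < m) (x < c) = c.
Proof.
elim: m c => [|m IH] c le_c; first by rewrite big_ord0; lia.
rewrite big_ord_recr /=; have [le_cm|lt_mc] := leqP c m.
  by rewrite IH // addn0.
have {le_c lt_mc} -> : c = m.+1 by lia.
rewrite -[RHS]addn1; congr (_ + _); rewrite -[RHS](IH m (leqnn m)).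
by apply: eq_bigr => x _; rewrite ltn_ord ltnW // ltnS ltn_ord.
Qed.

Lemma sum_gt m x : \sum_(j < m) (x < j) = m - x.+1.
Proof.
elim: m => [|m IH]; first by rewrite big_ord0.
by rewrite big_ord_recr /= IH; case: ltnP; lia.
Qed.

Section Rankings.

Variables (m : nat) (s : {perm 'I_m}).

(* This is [m] if [t] is empty. *)
Definition best_pos (t : seq 'I_m) := find (fun j => (s^-1)%g j \in t) (enum 'I_m).

Lemma best_pos_leq t a : a \in t -> best_pos t <= s a.
Proof.
move=> a_t; rewrite leqNgt; apply/negP => lt_a.
by have := before_find a lt_a; rewrite nth_ord_enum permK a_t.
Qed.

Lemma best_posP t : t != [::] -> exists2 a, a \in t & s a = best_pos t :> nat.
Proof.
case: t => // b t _; set u := b :: t.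
have h : has (fun j => (s^-1)%g j \in u) (enum 'I_m).
  by apply/hasP; exists (s b); rewrite ?mem_enum // permK mem_head.
have lt_m : best_pos u < m by move: h; rewrite has_find size_enum_ord.
have := nth_find b h; rewrite -/(best_pos u) => a_u.
exists ((s^-1)%g (nth b (enum 'I_m) (best_pos u))) => //.
by rewrite permKV nth_enum_ord.
Qed.

Lemma best_pos_lt t : t != [::] -> best_pos t < m.
Proof. by move/best_posP=> [a _ <-]. Qed.

Lemma size_ranking : size (ranking s) = m.
Proof. by rewrite size_map size_enum_ord. Qed.

Lemma mem_ranking (a : 'I_m) : val a \in ranking s.
Proof. by apply/mapP; exists (s a); rewrite ?mem_enum ?permK. Qed.

Lemma rankingP b : b \in ranking s -> exists a : 'I_m, b = val a.
Proof. by case/mapP=> j _ ->; exists ((s^-1)%g j). Qed.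

Definition word (a : 'I_m) := bin (val a).

Lemma word_inj : injective word.
Proof. by move=> a b /bin_inj/val_inj. Qed.

Lemma find_ranking t : find (fun w => w \in map word t) (map bin (ranking s)) = best_pos t.
Proof.
rewrite /ranking -map_comp find_map; apply: eq_find => j /=.
by rewrite -[bin _]/(word _) mem_map //; exact: word_inj.
Qed.

Lemma nth_ranking t a : s a = best_pos t :> nat ->
  nth [::] (map bin (ranking s)) (best_pos t) = word a.
Proof.
move=> <-; rewrite (nth_map 0) ?size_ranking // (nth_map a) ?size_enum_ord //.
by rewrite nth_ord_enum permK.
Qed.

(** The minimum of the positions exceeds [x] iff all of them do; this makes the event a product over
    the [q] coordinates. *)
Lemma ltn_best_pos q (f : {ffun 'I_q -> 'I_m}) (x : 'I_m) :
  (x < best_pos (codom f)) = (f \in ffun_on (fun a => x < s a)).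
Proof.
apply/idP/ffun_onP => [lt_x i|H].
  by apply: leq_trans lt_x (best_pos_leq _); apply: codom_f.
(* For [q = 0] the best position is [m] by convention, and both sides hold. *)
have [/eqP f0|] := boolP (codom f == [::]).
  by rewrite /best_pos hasNfind ?size_enum_ord // f0; apply/hasPn.
by case/best_posP=> a /codomP[i ->] <-; apply: H.
Qed.

Lemma card_worse (x : 'I_m) : #|[pred a | x < s a]| = m - x.+1.
Proof.
rewrite -sum1_card big_mkcond /= (reindex_inj (@perm_inj _ s^-1)) /=.
under eq_bigr => j _ do rewrite inE permKV.
by rewrite -(sum_gt m x); apply: eq_bigr => j _; case: ltnP.
Qed.

(** A position is the number of the [x] below it. Exchanging the sums leaves, for each [x], the
    number of tuples with all positions beyond [x], namely [(m - x.+1) ^ q]; reversing the order of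
    the [x] gives the powers. *)
Lemma sum_best_pos q :
  \sum_(f : {ffun 'I_q -> 'I_m}) best_pos (codom f) = \sum_(x < m) x ^ q.
Proof.
have bpE (f : {ffun 'I_q -> 'I_m}) :
    best_pos (codom f) = \sum_(x < m) (x < best_pos (codom f)).
  by rewrite sum_lt // -[leqRHS](size_enum_ord m) find_size.
under eq_bigr => f _ do rewrite bpE.
rewrite exchange_big (reindex_inj rev_ord_inj); apply: eq_bigr => x _.
under eq_bigr => f _ do rewrite (ltn_best_pos _ (rev_ord x)).
transitivity #|[pred f : {ffun 'I_q -> 'I_m} | f \in ffun_on [pred a | rev_ord x < s a]]|.
  by rewrite -sum1_card [RHS]big_mkcond; apply: eq_bigr => f _; case: (f \in _).
rewrite card_ffun_on card_ord card_worse /=.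
by congr (_ ^ _); have := ltn_ord x; lia.
Qed.

End Rankings.

(** * Sums of powers and averaging *)

Lemma leq_bernoulli a q : a ^ q.+1 + q.+1 * a ^ q <= a.+1 ^ q.+1.
Proof.
elim: q => [|q IH]; first by rewrite !expn1 expn0; lia.
have := leq_mul (leqnn a.+1) IH; rewrite -expnS.
apply: leq_trans; rewrite !expnS; move: (a ^ q) => b; nia.
Qed.

(** The discrete form of integrating [x ^ q]: the differences of [x ^ q.+1] dominate [q.+1 * x ^ q]
    and telescope. *)
Lemma leq_sum_powers q m : q.+1 * (\sum_(x < m) x ^ q) <= m ^ q.+1.
Proof.
elim: m => [|m IH]; first by rewrite big_ord0 muln0.
by rewrite big_ord_recr mulnDr; apply: leq_trans (leq_bernoulli m q); rewrite leq_add2r.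
Qed.


(* Averaging over all q-tuples of alternatives. *)
Lemma good_tuple n m q (prof : 'I_n -> {perm 'I_m}) : 0 < m ->
  exists2 t : seq 'I_m, size t = q &
    q.+1 * (\sum_(i < n) best_pos (prof i) t) <= n * m.
Proof.
move=> m0; pose B (f : {ffun 'I_q -> 'I_m}) :=
  q.+1 * (\sum_(i < n) best_pos (prof i) (codom f)).
have [/existsP[f Hf]|/existsPn H] := boolP [exists f, B f <= n * m].
  by exists (codom f) => //; rewrite size_codom card_ord.
have le_sum : \sum_f B f <= m ^ q * (n * m).
  rewrite -big_distrr exchange_big /=.
  under eq_bigr => i _ do rewrite sum_best_pos.
  rewrite sum_nat_const card_ord mulnCA [leqRHS]mulnCA leq_mul2l -expnSr.
  by rewrite leq_sum_powers orbT.
have : \sum_(f : {ffun 'I_q -> 'I_m}) (n * m).+1 <= \sum_f B f.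
  by apply: leq_sum => f _; rewrite ltnNge H.
rewrite sum_nat_const card_ffun !card_ord => /leq_trans/(_ le_sum).
by rewrite leq_pmul2l ?expn_gt0 ?m0 // ltnn.
Qed.

(** * The approximation scheme *)

Section Instance.

Variables (n m K : nat) (prof : 'I_n -> {perm 'I_m}).

Definition ranking_words := [seq map bin (ranking (prof i)) | i <- enum 'I_n].

Lemma enc_instanceE : enc_instance K prof =
  enc_words [:: bin n, bin m, bin K & flatten ranking_words].
Proof.
rewrite /enc_instance enc_natsE /= map_flatten -map_comp.
by congr (enc_words [:: _, _, _ & flatten _]).
Qed.

Lemma ranking_wordsP w : w \in flatten ranking_words -> exists a : 'I_m, w = word a.
Proof.
case/flattenP=> r /mapP[i _ ->] /mapP[b /rankingP[a ->] ->].
by exists a.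
Qed.

Lemma mem_ranking_words w r : r \in ranking_words -> w \in flatten ranking_words ->
  w \in r.
Proof.
by case/mapP=> i _ -> /ranking_wordsP[a ->]; apply/map_f/mem_ranking.
Qed.

Lemma words_of_alternatives (T : seq (seq sym)) : {subset T <= flatten ranking_words} ->
  exists t : seq 'I_m, T = map (@word m) t.
Proof.
elim: T => [|w T IH] sub; first by exists [::].
have [|t ->] := IH; first by move=> v v_in; apply: sub; rewrite in_cons v_in orbT.
have [a ->] := ranking_wordsP (sub w (mem_head _ _)).
by exists (a :: t).
Qed.

Lemma alternatives_words (t : seq 'I_m) : 0 < n ->
  {subset map (@word m) t <= flatten ranking_words}.
Proof.
move=> n0 w /mapP[a _ ->]; apply/flattenP.
exists (map bin (ranking (prof (Ordinal n0)))); first by apply: map_f; rewrite mem_enum.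
exact/map_f/mem_ranking.
Qed.

Definition tuple_score (t : seq 'I_m) := \sum_(i < n) (m - (best_pos (prof i) t).+1).

Lemma scoreE t :
  score m (fun w => w \in map (@word m) t) ranking_words = tuple_score t.
Proof.
rewrite /score sumnE big_map big_map big_enum; apply: eq_bigr => i _.
by rewrite find_ranking.
Qed.

Lemma assignmentE t (Phi : 'I_n -> 'I_m) :
  (forall i, prof i (Phi i) = best_pos (prof i) t :> nat) ->
  assignment (fun w => w \in map (@word m) t) ranking_words = enc_assignment Phi.
Proof.
move=> HP; rewrite /assignment /enc_assignment enc_natsE /ranking_words -!map_comp.
congr enc_words; apply: eq_map => i /=.
by rewrite find_ranking (nth_ranking (HP i)).
Qed.

Lemma ell1_leq (Phi : 'I_n -> 'I_m) t : (forall i, Phi i \in t) ->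
  ell1 prof Phi <= tuple_score t.
Proof.
move=> sub; apply: leq_sum => i _; apply: leq_sub2l.
by rewrite /pos ltnS best_pos_leq.
Qed.

(** The image of [Phi] is padded to size exactly [K] with an arbitrary alternative; each agent's
    best choice in the tuple is at least as good as [Phi]. *)
Lemma tuple_of_assignment (Phi : 'I_n -> 'I_m) : 0 < m -> is_K_assignment K Phi ->
  exists2 t, size t = K & ell1 prof Phi <= tuple_score t.
Proof.
rewrite /is_K_assignment; set S := [set Phi i | i in _] => m0 cardS.
exists (take K (enum S ++ nseq K (Ordinal m0))).
  by rewrite size_takel // size_cat size_nseq leq_addl.
apply: ell1_leq => i; rewrite take_cat -cardE ltnNge cardS /= mem_cat mem_enum.
by rewrite imset_f.
Qed.

Lemma sum_max : n * m.-1 = \sum_(i < n) m.-1.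
Proof. by rewrite sum_nat_const card_ord. Qed.

Lemma ell1_max (Phi : 'I_n -> 'I_m) : ell1 prof Phi <= n * m.-1.
Proof.
rewrite sum_max; apply: leq_sum => i _.
by rewrite /pos; lia.
Qed.

Lemma tuple_scoreD t : t != [::] ->
  tuple_score t + \sum_(i < n) best_pos (prof i) t = n * m.-1.
Proof.
move=> tN; rewrite -big_split sum_max /=.
by apply: eq_bigr => i _; have := best_pos_lt (prof i) tN; lia.
Qed.

End Instance.

Local Open Scope ring_scope.

Lemma good_tuple_ratio (R : realType) (r : R) n m q (prof : 'I_n -> {perm 'I_m}) :
  0 <= r -> (0 < m)%N -> (0 < q)%N -> 2 <= (1 - r) * q.+1%:R ->
  exists2 t : seq 'I_m, size t = q &
    r * (n * m.-1)%N%:R <= (tuple_score prof t)%:R.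
Proof.
move=> r0 m0 q0 r_q; have [t st le_S] := good_tuple q prof m0.
exists t => //; have tN : t != [::] by rewrite -size_eq0 st -lt0n.
have := tuple_scoreD prof tN; move: le_S; set S := (\sum_(i < n) _)%N.
move=> le_S <-; have [m1|m_gt1] := leqP m 1.
  have -> : (tuple_score prof t + S)%N = 0%N.
    by rewrite (tuple_scoreD prof tN) (_ : m.-1 = 0%N) ?muln0 //; lia.
  by rewrite mulr0 ler0n.
(* Uses [m <= 2 * m.-1], valid as [m] is at least 2 here. *)
have : (q.+1 * S <= 2 * (tuple_score prof t + S))%N.
  by rewrite (tuple_scoreD prof tN); apply: leq_trans le_S _; nia.
rewrite -(ler_nat R) !natrM !natrD.
move: (tuple_score prof t)%:R (S%:R : R) (ler0n R (tuple_score prof t)) (ler0n R S).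
move=> a b a0 b0 le_b.
have q1 : 0 < q.+1%:R :> R by rewrite ltr0n.
have ab0 : 0 <= a + b by rewrite addr_ge0.
have := ler_wpM2r ab0 r_q => H.
have : q.+1%:R * b <= q.+1%:R * ((1 - r) * (a + b)).
  by apply: le_trans le_b (le_trans H _); rewrite mulrCA mulrA.
by rewrite ler_pM2l //; lra.
Qed.

Theorem mainTheorem15 (R : realType) (r : R) :
  0 < r < 1 ->
  exists (M : TM) (c k : nat),
    forall (n m K : nat) (prof : 'I_n -> {perm 'I_m}),
      (0 < m)%N -> (0 < K)%N ->
      exists Phi : 'I_n -> 'I_m,
        [/\ is_K_assignment K Phi,
            (ell1 prof Phi)%:R >= r * (OPT K prof)%:R
          & halts_within M (enc_instance K prof)
              (c * (size (enc_instance K prof)) ^ k + c)%N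
              (enc_assignment Phi)].
Proof.
move=> /andP[r0 r1].
have r1' : 0 < 1 - r by rewrite subr_gt0.
(* The Archimedean bound depends on [r] alone; the successor makes [q] positive. *)
pose q := (Num.bound (2 / (1 - r))).+1.
have r_q : 2 <= (1 - r) * q.+1%:R.
  rewrite mulrC -ler_pdivrMr //; apply: le_trans (ltW (archi_boundP _)) _.
    by rewrite divr_ge0 // ltW.
  by rewrite ler_nat; apply: leqW (leqnSn _).
(* There are 15 fixed variables and [q] slots; taking [q] also as the additive constant gives
   [q <= N]. *)
have [M [c [k HM]]] := @com_machine (15 + q)%N q isT (program q) (com_ok_program q).
exists M, c, k => n m K prof m0 K0.
pose rks := ranking_words prof.
have bits : all bit_word [:: bin n, bin m, bin K & flatten rks].
  rewrite /= !bit_word_bin /=; apply/allP => w /ranking_wordsP[a ->].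
  exact: bit_word_bin.
set x := enc_instance K prof.
have xE : x = enc_words [:: bin n, bin m, bin K & flatten rks] by exact: enc_instanceE.
have nbx : SB \notin x by rewrite xE; apply: enc_words_nonblank.
have size_rks : all (fun r => size r == bits_value (bin m)) rks.
  by apply/allP => _ /mapP[i _ ->]; rewrite size_map size_ranking bits_value_bin.
have HT := HM x nbx.
have K0' : (0 < bits_value (bin K))%N by rewrite bits_value_bin.
have perm_rks r' w : r' \in rks -> w \in flatten rks -> w \in r'.
  by move=> r'_in w_in; apply: mem_ranking_words w_in.
have leqN : (size (enc_words [:: bin n, bin m, bin K & flatten rks]) <= size x + q)%N.
  by rewrite -xE leq_addr.
have qN : (q <= size x + q)%N by rewrite leq_addl.
have [n0|n_gt0] := posnP n.
  have rks0 : rks = [::].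
    by rewrite /rks /ranking_words (size0nil (_ : size (enum 'I_n) = 0%N)) ?size_enum_ord.
  have := exec_program_nil (ltn0Sn _ : (0 < q)%N) qN leqN bits K0' rks0.
  rewrite -xE => out0; rewrite out0 in HT.
  (* Without agents the image is empty, [OPT] is 0 and the output is the empty word. *)
  exists (fun i => Ordinal m0); split.
  - rewrite /is_K_assignment; apply: leq_trans (ltnW K0); rewrite leqn0 cards_eq0.
    apply/eqP/setP => a; rewrite inE; apply/imsetP => -[i _ _].
    by have := leq_ltn_trans (leq0n i) (ltn_ord i); rewrite n0.
  - rewrite [OPT _ _](_ : _ = 0%N) ?mulr0 ?ler0n //; apply/eqP; rewrite -leqn0.
    apply/bigmax_leqP => Phi _; apply: leq_trans (ell1_max _ _) _.
    by rewrite n0 mul0n.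
  by rewrite /enc_assignment (size0nil (_ : size (enum 'I_n) = 0%N)) ?size_enum_ord.
have rksN : rks != [::].
  by rewrite -size_eq0 size_map size_enum_ord -lt0n.
have m0' : (0 < bits_value (bin m))%N by rewrite bits_value_bin.
have [T [sT subT] [outE T_max]] :=
  exec_program (ltn0Sn _ : (0 < q)%N) qN leqN bits K0' size_rks perm_rks rksN m0'.
rewrite -xE in outE; rewrite !bits_value_bin in sT T_max.
have [t tE] := words_of_alternatives subT; rewrite {T}tE size_map in sT subT outE T_max.
have tN : t != [::] by rewrite -size_eq0 sT; lia.
have t_max t' : size t' = minn q K -> (tuple_score prof t' <= tuple_score prof t)%N.
  move=> st'; rewrite -!scoreE; apply: T_max; first by rewrite size_map.
  exact: alternatives_words.
have [Phi Phi_t Phi_best] := fin_all_exists2 (fun i => best_posP (prof i) tN).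
have ellE : ell1 prof Phi = tuple_score prof t.
  by apply: eq_bigr => i _; rewrite /pos Phi_best.
exists Phi; split.
- rewrite /is_K_assignment; have sub : [set Phi i | i in 'I_n] \subset [set a in t].
    by apply/subsetP => _ /imsetP[i _ ->]; rewrite inE.
  apply: leq_trans (subset_leq_card sub) _; rewrite cardsE.
  by apply: leq_trans (card_size t) _; rewrite sT geq_minr.
- rewrite ellE; have [le_Kq|lt_qK] := leqP K q.
    apply: (@le_trans _ _ (OPT K prof)%:R).
      by rewrite ler_piMl ?ler0n // ltW.
    rewrite ler_nat; apply/bigmax_leqP => Psi HPsi.
    have [t' st' le_t'] := tuple_of_assignment prof m0 HPsi.
    by apply: leq_trans le_t' (t_max _ _); rewrite st' (minn_idPr le_Kq).
  have [t' st' le_t'] := good_tuple_ratio prof (ltW r0) m0 (ltn0Sn _ : (0 < q)%N) r_q.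
  apply: (@le_trans _ _ (r * (n * m.-1)%N%:R)).
    rewrite ler_pM2l // ler_nat; apply/bigmax_leqP => Psi _; exact: ell1_max.
  apply: le_trans le_t' _; rewrite ler_nat; apply: t_max.
  by rewrite st' (minn_idPl (ltnW lt_qK)).
by move: HT; rewrite outE (assignmentE Phi_best).
Qed.
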